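(* Let $s>\frac12$. Assume $u\in C^\infty(\mathbb{R},H^s_+(\mathbb{T}))$ is a solution of $$ i\partial_t u=2J\Pi(|u|^2)+\overline{J}u^2,\qquad J:=(u^2\vert u).$$ Then we have the Lax pair identity $$\frac{d}{dt}K_u=B_uK_u-K_uB_u,$$ where $B_u:=-i(T_{\overline{J}u}+T_{J\bar u})$ is a well-defined anti-self-adjoint operator on $L^2_+$.
   Context: $\mathbb{T}$ is the one-dimensional torus; $(f\vert g):=\frac1{2\pi}\int_0^{2\pi}f(e^{ix})\overline{g(e^{ix})}\,dx$. $L^2_+(\mathbb{T})=\{u\in L^2(\mathbb{T}) : \hat u(k)=0\ \forall k<0\}$, $\Pi:L^2(\mathbb{T})\to L^2_+(\mathbb{T})$ is the orthogonal projection, and $H^s_+:=H^s\cap L^2_+$. For $u\in H^{1/2}_+$, the Hankel operator is the $\mathbb{C}$-antilinear operator $H_u:L^2_+\to L^2_+$, $H_u(h)=\Pi(u\bar h)$. For $b\in L^\infty(\mathbb{T})$, the Toeplitz operator is the $\mathbb{C}$-linear operator $T_b:L^2_+\to L^2_+$, $T_b(h)=\Pi(bh)$. The shift is $S:=T_{e^{ix}}$, with adjoint $S^*=T_{e^{-ix}}$. The shifted Hankel operator is the $\mathbb{C}$-antilinear operator $K_u:=S^*H_u$, i.e. $K_u(h)=\Pi(e^{-ix}u\bar h)$. *)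

(* Defs.v *)
From HB Require Import structures.
From mathcomp Require Import all_boot all_order all_algebra.
From mathcomp Require Import all_classical all_reals all_analysis.
From mathcomp Require Import complex.

Set Implicit Arguments.
Unset Strict Implicit.
Unset Printing Implicit Defensive.

Import Order.TTheory GRing.Theory Num.Theory.
Import numFieldNormedType.Exports.

Local Open Scope classical_set_scope.
Local Open Scope ring_scope.
Local Open Scope complex_scope.

Section Torus.
Variable R : realType.

Local Notation mu := (@lebesgue_measure R).
Local Notation normc := ComplexField.Normc.normc.

(* A function F on the torus is represented by x |-> F (e^{ix}); only its
   restriction to `[0, 2 pi] is ever used, and equality in L^2(T) is
   [torus_ae_eq]. *)
Definition torus_fun : Type := R -> R[i].

Implicit Types (f g h u w b : torus_fun) (s t tau : R) (k : int).

Definition torus : set R := `[0, 2 * pi].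

Definition torus_ae_eq f g := {ae mu, forall x, torus x -> f x = g x}.

Definition torus_measurable f :=
  measurable_fun torus (fun x => complex.Re (f x)) /\
  measurable_fun torus (fun x => complex.Im (f x)).

Definition cintegral f : R[i] :=
  (\int[mu]_(x in torus) complex.Re (f x))
  +i* (\int[mu]_(x in torus) complex.Im (f x)).

Definition inner f g : R[i] :=
  ((2 * pi)^-1)%:C * cintegral (fun x => f x * ((g x)^*)%C).

Definition L2norm f : \bar R :=
  (((2 * pi)^-1)%:E * \int[mu]_(x in torus) (normc (f x) ^+ 2)%:E) `^ 2^-1.

Definition in_L2 f := torus_measurable f /\ (L2norm f < +oo)%E.

Definition in_Loo b :=
  torus_measurable b /\
  exists M : R, {ae mu, forall x, torus x -> normc (b x) <= M}.

(* [cexp k] is x |-> e^{ikx}. *)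
Definition cexp k : torus_fun := fun x => cos (k%:~R * x) +i* sin (k%:~R * x).

Definition fourier f k : R[i] := inner f (cexp k).

Definition in_L2plus f := in_L2 f /\ forall k, k < 0 -> fourier f k = 0.

Definition Hsnorm s f : \bar R :=
  (\esum_(k in [set: int])
     ((1 + k%:~R ^+ 2) `^ s * normc (fourier f k) ^+ 2)%:E) `^ 2^-1.

Definition in_Hsplus s f := in_L2plus f /\ (Hsnorm s f < +oo)%E.

Definition is_orthoproj f g :=
  in_L2plus g /\
  forall h, in_L2plus h -> inner (fun x => f x - g x) h = 0.

(* For f in L^2(T), [Pi f] is a representative of the orthogonal projection of
   f onto L^2_+; the default value 0 is only taken when f has none. *)
Definition Pi f : torus_fun := xget (fun=> 0) [set g | is_orthoproj f g].

Definition Hankel u h : torus_fun := Pi (fun x => u x * ((h x)^*)%C).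

Definition Toeplitz b h : torus_fun := Pi (fun x => b x * h x).

Definition shift_adj : torus_fun -> torus_fun := Toeplitz (cexp (- 1)).

Definition shifted_Hankel u h : torus_fun := shift_adj (Hankel u h).

Definition opnorm (A : torus_fun -> torus_fun) : \bar R :=
  ereal_sup [set L2norm (A h) | h in [set h | in_L2plus h /\ (L2norm h <= 1)%E]].

(* A bounded C-linear operator on L^2_+; the second clause says that A is
   compatible with equality in L^2. *)
Definition bounded_linear_L2plus (A : torus_fun -> torus_fun) :=
  [/\ forall h, in_L2plus h -> in_L2plus (A h),
      forall h1 h2, in_L2plus h1 -> in_L2plus h2 ->
        torus_ae_eq h1 h2 -> torus_ae_eq (A h1) (A h2),
      forall (c : R[i]) h1 h2, in_L2plus h1 -> in_L2plus h2 ->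
        torus_ae_eq (A (fun x => c * h1 x + h2 x))
                    (fun x => c * A h1 x + A h2 x)
    & (opnorm A < +oo)%E].

Definition anti_selfadjoint (A : torus_fun -> torus_fun) :=
  forall h1 h2, in_L2plus h1 -> in_L2plus h2 ->
    inner (A h1) h2 = - inner h1 (A h2).

Definition Hs_deriv s (u : R -> torus_fun) t w :=
  Hsnorm s (fun x => (tau^-1)%:C * (u (t + tau) x - u t x) - w x)
    @[tau --> 0^'] --> 0%E.

(* u belongs to C^oo(R, H^s_+): v n is the n-th time derivative of u. *)
Definition smooth_Hsplus s (u : R -> torus_fun) :=
  exists v : nat -> R -> torus_fun,
    [/\ v 0%N = u,
        forall n t, in_Hsplus s (v n t)
      & forall n t, Hs_deriv s (v n) t (v n.+1 t)].

(* Derivative of an operator-valued map, in the operator norm of L^2_+. *)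
Definition op_deriv (A : R -> torus_fun -> torus_fun) t
    (A' : torus_fun -> torus_fun) :=
  opnorm (fun h x => (tau^-1)%:C * (A (t + tau) h x - A t h x) - A' h x)
    @[tau --> 0^'] --> 0%E.

Definition J u : R[i] := inner (fun x => u x ^+ 2) u.

Definition is_solution s (u : R -> torus_fun) :=
  forall t, exists ut : torus_fun,
    [/\ in_Hsplus s ut, Hs_deriv s u t ut
      & torus_ae_eq (fun x => 'i%C * ut x)
          (fun x => 2 * J (u t) * Pi (fun y => (normc (u t y) ^+ 2)%:C) x
                    + ((J (u t))^*)%C * u t x ^+ 2)].

Definition lax_symbol1 u : torus_fun := fun x => ((J u)^*)%C * u x.
Definition lax_symbol2 u : torus_fun := fun x => J u * ((u x)^*)%C.

Definition lax_B u h : torus_fun :=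
  fun x => - 'i%C * (Toeplitz (lax_symbol1 u) h x + Toeplitz (lax_symbol2 u) h x).

End Torus.

(* Main.v *)
Require Import Defs.
From HB Require Import structures.
From mathcomp Require Import all_boot all_order all_algebra.
From mathcomp Require Import all_classical all_reals all_analysis.
From mathcomp Require Import measurable_realfun.
From mathcomp Require Import complex.
From mathcomp Require Import ring lra zify.
Set Implicit Arguments.
Unset Strict Implicit.
Unset Printing Implicit Defensive.
Import Order.TTheory GRing.Theory Num.Theory.
Import numFieldNormedType.Exports.
Local Open Scope classical_set_scope.
Local Open Scope ring_scope.
Local Open Scope complex_scope.

(** Write e for e^{ix}, J for J(u), and (f|g) for the inner product.

    The operator K_u is real-linear in u, and K_u h is the projection on L^2_+ of
    conj(e) u conj(h), because multiplication by e preserves L^2_+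
    ([shifted_HankelP]). Its norm is thus at most the L^oo norm of u, and since
    H^s embeds in L^oo for s > 1/2 ([sobolev]) the derivative of K_u in operator
    norm is K_{u_t} ([shifted_Hankel_deriv]). The operator B_u is the Toeplitz
    operator of the bounded function - i (conj(J) u + J conj(u)), which is purely
    imaginary; so it is bounded and anti-self-adjoint. There remains the
    identity K_{u_t} = B_u K_u - K_u B_u ([lax_commutator]).

    Put q = conj(e) u conj(h). The negative frequencies of q are collected by the
    conjugate of Pi (conj(u) h) up to the factor conj(e), the nonnegative ones by
    K_u h ([shifted_Hankel_split]). Multiplying this splitting of q by u gives
    u K_u h + K_u (Pi (conj(u) h)) = K_{u^2} h, where u K_u h needs no projection:
    these are the terms of the commutator with factor conj(J), and they match
    the term conj(J) u^2 of the equation. The terms with factor J are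
    Pi (conj(u) K_u h) and K_u (u h); testing against L^2_+, where conj(u) moves
    to the other side as u, both are the projection of conj(e) |u|^2 conj(h), and
    |u|^2 may be replaced there by Pi (|u|^2), because the difference is
    orthogonal to L^2_+ ([inner_orthogonal]). That argument needs the
    difference to be bounded, which the equation itself provides after
    multiplication by J ([lax_defect]).

    All of this rests on the L^2 theory of Fourier series. The projection exists
    by the Riesz-Fischer theorem ([riesz_fischer]), and products of elements of
    L^2_+ are handled frequency by frequency ([inner_eq0]), which requires the
    trigonometric system to be complete ([fourier_injective]). For the latter,
    the indicator functions of intervals [0, b] are bounded almost everywhere
    limits of explicit trigonometric polynomials, so that a function with
    vanishing coefficients integrates to zero over each of these intervals, and
    Lebesgue differentiation applies. *)

(** * Complex-valued integrals on the torus *)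

Section ComplexIntegral.
Variable R : realType.

Local Notation mu := (@lebesgue_measure R).
Local Notation normc := ComplexField.Normc.normc.
Local Notation T := (@torus R).

Implicit Types (f g h b : torus_fun R) (a z c : R[i]) (k l : int).

Lemma ReD a z : complex.Re (a + z) = complex.Re a + complex.Re z.
Proof. by case: a; case: z. Qed.
Lemma ImD a z : complex.Im (a + z) = complex.Im a + complex.Im z.
Proof. by case: a; case: z. Qed.
Lemma ReN a : complex.Re (- a) = - complex.Re a.
Proof. by case: a. Qed.
Lemma ImN a : complex.Im (- a) = - complex.Im a.
Proof. by case: a. Qed.
Lemma ReM a z : complex.Re (a * z) =
  complex.Re a * complex.Re z - complex.Im a * complex.Im z.
Proof. by case: a; case: z. Qed.
Lemma ImM a z : complex.Im (a * z) =
  complex.Re a * complex.Im z + complex.Im a * complex.Re z.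
Proof. by case: a => x y; case: z => x' y'. Qed.
Lemma Re_conj z : complex.Re (z^*)%C = complex.Re z.
Proof. by case: z. Qed.
Lemma Im_conj z : complex.Im (z^*)%C = - complex.Im z.
Proof. by case: z. Qed.

Lemma conjcD a z : ((a + z)^*)%C = (a^*)%C + (z^*)%C.
Proof. exact: rmorphD. Qed.
Lemma conjcN a : ((- a)^*)%C = - (a^*)%C.
Proof. exact: rmorphN. Qed.
Lemma conjcB a z : ((a - z)^*)%C = (a^*)%C - (z^*)%C.
Proof. exact: rmorphB. Qed.
Lemma conjcM a z : ((a * z)^*)%C = (a^*)%C * (z^*)%C.
Proof. exact: rmorphM. Qed.

Lemma complex_ext a z : complex.Re a = complex.Re z ->
  complex.Im a = complex.Im z -> a = z.
Proof. by case: a; case: z => ? ? ? ? /= -> ->. Qed.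

Lemma normc_ge0 z : 0 <= normc z.
Proof. by case: z => x y; exact: sqrtr_ge0. Qed.

Lemma sqr_normcE z : normc z ^+ 2 = complex.Re z ^+ 2 + complex.Im z ^+ 2.
Proof. by case: z => x y; rewrite /= sqr_sqrtr// addr_ge0// sqr_ge0. Qed.

Lemma mulcJE z : z * (z^*)%C = (normc z ^+ 2)%:C.
Proof.
by rewrite sqr_normcE; case: z => x y; apply: complex_ext; rewrite /=; ring.
Qed.

Lemma normc_conj z : normc (z^*)%C = normc z.
Proof. by case: z => x y; rewrite /= sqrrN. Qed.

Lemma normr_Re_le z : `|complex.Re z| <= normc z.
Proof.
rewrite -[leRHS]ger0_norm ?normc_ge0// -ler_sqr ?nnegrE// !real_normK ?num_real//.
by rewrite sqr_normcE lerDl sqr_ge0.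
Qed.

Lemma normr_Im_le z : `|complex.Im z| <= normc z.
Proof.
rewrite -[leRHS]ger0_norm ?normc_ge0// -ler_sqr ?nnegrE// !real_normK ?num_real//.
by rewrite sqr_normcE lerDr sqr_ge0.
Qed.

Lemma normc_real (x : R) : normc (x%:C) = `|x|.
Proof. by rewrite /= expr0n addr0 sqrtr_sqr. Qed.

Lemma twopi_gt0 : 0 < 2 * pi :> R.
Proof. by rewrite mulr_gt0 ?pi_gt0. Qed.

Lemma measurable_torus : @measurable _ (measurableTypeR R) T.
Proof. exact: measurable_itv. Qed.
#[local] Hint Resolve measurable_torus : core.

Lemma torus_measure : mu T = (2 * pi)%:E.
Proof.
rewrite /torus lebesgue_measure_itv/= lte_fin twopi_gt0 EFinN sube0 //.
Qed.

Lemma torus_finite : (mu T < +oo)%E.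
Proof. by rewrite torus_measure ltry. Qed.

Definition cintegrable f :=
  mu.-integrable T (EFin \o (fun x => complex.Re (f x))) /\
  mu.-integrable T (EFin \o (fun x => complex.Im (f x))).

(** The real line carries two convertible Borel structures; the lemmas on
    integrals only unify with the one over which [lebesgue_measure] is built,
    hence the explicit [measurableTypeR] here and in what follows. *)
Lemma torus_measurableE f : torus_measurable f <->
  @measurable_fun _ _ (measurableTypeR R) R T (fun x => complex.Re (f x)) /\
  @measurable_fun _ _ (measurableTypeR R) R T (fun x => complex.Im (f x)).
Proof. by []. Qed.

Lemma torus_measurableD f g : torus_measurable f -> torus_measurable g ->
  torus_measurable (fun x => f x + g x).
Proof.
move=> [f1 f2] [g1 g2]; split.
- by under eq_fun do rewrite ReD; exact: measurable_funD.
- by under eq_fun do rewrite ImD; exact: measurable_funD.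
Qed.

Lemma torus_measurableM f g : torus_measurable f -> torus_measurable g ->
  torus_measurable (fun x => f x * g x).
Proof.
move=> [f1 f2] [g1 g2]; split.
- by under eq_fun do rewrite ReM; apply: measurable_funB; exact: measurable_funM.
- by under eq_fun do rewrite ImM; apply: measurable_funD; exact: measurable_funM.
Qed.

Lemma torus_measurable_conj f : torus_measurable f ->
  torus_measurable (fun x => ((f x)^*)%C).
Proof.
move=> [f1 f2]; split; first by under eq_fun do rewrite Re_conj.
under eq_fun do rewrite Im_conj.
by apply: measurableT_comp.
Qed.

Lemma torus_measurable_cst c : torus_measurable (fun=> c).
Proof. by split; exact: measurable_cst. Qed.

Lemma torus_measurableZ c f : torus_measurable f ->
  torus_measurable (fun x => c * f x).
Proof. by move=> mf; apply: torus_measurableM => //; exact: torus_measurable_cst. Qed.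

Lemma torus_measurableB f g : torus_measurable f -> torus_measurable g ->
  torus_measurable (fun x => f x - g x).
Proof.
move=> mf mg; have := torus_measurableD mf (torus_measurableZ (-1) mg).
by under [X in torus_measurable X -> _]eq_fun do rewrite mulN1r.
Qed.

Lemma torus_measurable_normc f : torus_measurable f ->
  @measurable_fun _ _ (measurableTypeR R) R T (fun x => normc (f x) ^+ 2).
Proof.
move=> /torus_measurableE[f1 f2]; under eq_fun do rewrite sqr_normcE.
by apply: measurable_funD; apply: measurable_funX.
Qed.

Lemma cintegral_conj f : cintegrable f ->
  cintegral (fun x => ((f x)^*)%C) = ((cintegral f)^*)%C.
Proof.
move=> [_ f2]; apply: complex_ext => /=.
- by under eq_Rintegral do rewrite Re_conj.
- under eq_Rintegral do rewrite Im_conj -mulN1r.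
  by rewrite RintegralZl// mulN1r.
Qed.

Lemma cintegralD f g : cintegrable f -> cintegrable g ->
  cintegral (fun x => f x + g x) = cintegral f + cintegral g.
Proof.
move=> [f1 f2] [g1 g2]; apply: complex_ext => /=.
- by under eq_Rintegral do rewrite ReD; rewrite RintegralD.
- by under eq_Rintegral do rewrite ImD; rewrite RintegralD.
Qed.

Lemma cintegralZ c f : cintegrable f ->
  cintegral (fun x => c * f x) = c * cintegral f.
Proof.
move=> [f1 f2]; apply: complex_ext; rewrite ?ReM ?ImM /=.
- under eq_Rintegral do rewrite ReM.
  rewrite RintegralB ?RintegralZl//.
  + by have := integrableZl measurable_torus (complex.Re c) f1.
  + by have := integrableZl measurable_torus (complex.Im c) f2.
- under eq_Rintegral do rewrite ImM.
  rewrite RintegralD ?RintegralZl//.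
  + by have := integrableZl measurable_torus (complex.Re c) f2.
  + by have := integrableZl measurable_torus (complex.Im c) f1.
Qed.

#[global] Instance lebesgue_ae_filter : Filter (nbhs (almost_everywhere mu)).
Proof. exact: ae_filter_ringOfSetsType. Qed.

Lemma torus_ae_eq_refl f : torus_ae_eq f f.
Proof. by apply: (@filterE _ (almost_everywhere mu)). Qed.

Lemma torus_ae_eq_lift2 (F : R -> R[i] -> R[i] -> R[i]) f f' g g' :
  torus_ae_eq f f' -> torus_ae_eq g g' ->
  torus_ae_eq (fun x => F x (f x) (g x)) (fun x => F x (f' x) (g' x)).
Proof. by apply: filterS2 => x ff gg Tx; rewrite ff// gg. Qed.

Lemma torus_ae_eq_lift (F : R -> R[i] -> R[i]) f f' :
  torus_ae_eq f f' -> torus_ae_eq (fun x => F x (f x)) (fun x => F x (f' x)).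
Proof. by apply: filterS => x ff Tx; rewrite ff. Qed.

Lemma cintegral_ae_eq f g : torus_measurable f -> torus_measurable g ->
  torus_ae_eq f g -> cintegral f = cintegral g.
Proof.
move=> /torus_measurableE[f1 f2] /torus_measurableE[g1 g2] fg; apply: complex_ext => /=; congr fine;
  apply: ae_eq_integral => //; do ?exact/measurable_EFinP.
- by apply: filterS fg => x + Tx => ->.
- by apply: filterS fg => x + Tx => ->.
Qed.

End ComplexIntegral.
#[global] Hint Resolve measurable_torus : core.

(** * The inner product of L^2 *)

Section L2.
Variable R : realType.

Local Notation mu := (@lebesgue_measure R).
Local Notation normc := ComplexField.Normc.normc.
Local Notation T := (@torus R).

Implicit Types (f g h b : torus_fun R) (a z c : R[i]) (k l : int).

(** The squared norm as a real number: unlike [L2norm], it can be expanded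
    algebraically once f is known to be in L^2. *)
Definition L2sq f : R :=
  (2 * pi)^-1 * \int[mu]_(x in T) (normc (f x) ^+ 2).

Lemma cintegrable_le f (g : R -> R) : torus_measurable f ->
  mu.-integrable T (EFin \o g) -> (forall x, T x -> normc (f x) <= g x) ->
  cintegrable f.
Proof.
move=> /torus_measurableE[f1 f2] ig fg; split.
- apply: le_integrable ig => //; first exact/measurable_EFinP.
  move=> x Tx /=; rewrite lee_fin (le_trans (normr_Re_le _))//.
  by rewrite (le_trans (fg _ Tx))// ler_norm.
- apply: le_integrable ig => //; first exact/measurable_EFinP.
  move=> x Tx /=; rewrite lee_fin (le_trans (normr_Im_le _))//.
  by rewrite (le_trans (fg _ Tx))// ler_norm.
Qed.

Lemma L2norm_ltyE f :
  (L2norm f < +oo)%E = (\int[mu]_(x in T) (normc (f x) ^+ 2)%:E < +oo)%E.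
Proof.
rewrite /L2norm; set I := integral _ _ _.
have I0 : (0 <= I)%E by apply: integral_ge0 => x _; rewrite lee_fin sqr_ge0.
have p0 : 0 < (2 * pi)^-1 :> R by rewrite invr_gt0 twopi_gt0.
clearbody I; case: I I0 => [r| |//] I0; first by rewrite -EFinM !ltry.
by rewrite gt0_muley ?lte_fin// poweRyr ?invr_eq0.
Qed.

Lemma in_L2P f : in_L2 f <-> torus_measurable f /\
  mu.-integrable T (EFin \o (fun x => normc (f x) ^+ 2)).
Proof.
rewrite /in_L2 L2norm_ltyE; split=> -[mf If]; split=> //.
- apply/integrableP; split.
    by apply/measurable_EFinP; exact: torus_measurable_normc.
  under eq_integral do rewrite /= ger0_norm ?sqr_ge0//.
  exact: If.
- move/integrableP : If => [_]; apply: le_lt_trans.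
  by under [leRHS]eq_integral do rewrite /= ger0_norm ?sqr_ge0//.
Qed.

Lemma L2normE f : in_L2 f -> L2norm f = (Num.sqrt (L2sq f))%:E.
Proof.
move=> /in_L2P[mf If]; rewrite /L2norm /L2sq.
rewrite -[integral _ _ _]fineK; last exact: integrable_fin_num.
rewrite -EFinM poweR_EFin powR12_sqrt//.
by rewrite mulr_ge0 ?invr_ge0 ?(ltW (twopi_gt0 R))// Rintegral_ge0// => x _; rewrite sqr_ge0.
Qed.

Lemma L2sq_ge0 f : 0 <= L2sq f.
Proof.
by rewrite mulr_ge0 ?invr_ge0 ?(ltW (twopi_gt0 R))// Rintegral_ge0// => x _; rewrite sqr_ge0.
Qed.

Lemma L2norm_le f (M : R) : in_L2 f -> 0 <= M ->
  (L2norm f <= M%:E)%E = (L2sq f <= M ^+ 2).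
Proof.
move=> f2 M0; rewrite L2normE// lee_fin.
by rewrite -(ler_sqr (x := Num.sqrt _)) ?nnegrE ?sqrtr_ge0// sqr_sqrtr// L2sq_ge0.
Qed.

Lemma in_L2_le f (g : R -> R) : torus_measurable f ->
  mu.-integrable T (EFin \o g) -> (forall x, normc (f x) ^+ 2 <= g x) ->
  in_L2 f.
Proof.
move=> mf ig fg; apply/in_L2P; split => //.
apply: le_integrable ig => //.
  by apply/measurable_EFinP; exact: torus_measurable_normc.
by move=> x Tx /=; rewrite lee_fin ger0_norm ?sqr_ge0// (le_trans (fg _))// ler_norm.
Qed.

Lemma in_L2D f g : in_L2 f -> in_L2 g -> in_L2 (fun x => f x + g x).
Proof.
move=> /in_L2P[mf If] /in_L2P[mg Ig].
have I2 := integrableD (@measurable_torus R) (integrableZl (@measurable_torus R) 2 If)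
  (integrableZl (@measurable_torus R) 2 Ig).
apply: (in_L2_le (g := fun x => 2 * normc (f x) ^+ 2 + 2 * normc (g x) ^+ 2)).
- exact: torus_measurableD.
- exact: I2.
- move=> x; rewrite !sqr_normcE ReD ImD.
  have := sqr_ge0 (complex.Re (f x) - complex.Re (g x)).
  by have := sqr_ge0 (complex.Im (f x) - complex.Im (g x)); nra.
Qed.

Lemma in_L2Z c f : in_L2 f -> in_L2 (fun x => c * f x).
Proof.
move=> /in_L2P[mf If].
apply: (in_L2_le (g := fun x => normc c ^+ 2 * normc (f x) ^+ 2)).
- exact: torus_measurableZ.
- exact: (integrableZl (@measurable_torus R) (normc c ^+ 2) If).
- by move=> x; rewrite ComplexField.Normc.normcM exprMn.
Qed.

Lemma in_L2B f g : in_L2 f -> in_L2 g -> in_L2 (fun x => f x - g x).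
Proof.
move=> Lf Lg; have := in_L2D Lf (in_L2Z (-1) Lg).
by under [X in in_L2 X -> _]eq_fun do rewrite mulN1r.
Qed.

Lemma in_L2_conj f : in_L2 f -> in_L2 (fun x => ((f x)^*)%C).
Proof.
move=> /in_L2P[mf If]; apply/in_L2P; split; first exact: torus_measurable_conj.
by rewrite /comp; under eq_fun do rewrite normc_conj.
Qed.

Lemma in_L2_0 : in_L2 (fun=> 0 : R[i]).
Proof.
apply/in_L2P; split; first exact: torus_measurable_cst.
rewrite (_ : EFin \o _ = cst 0%E); first exact: integrable0.
by apply/funext => x /=; rewrite expr0n/= addr0 sqrtr0 expr0n.
Qed.

Lemma in_L2_sum (I : Type) (r : seq I) (F : I -> torus_fun R) :
  (forall i, in_L2 (F i)) -> in_L2 (fun x => \sum_(i <- r) F i x).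
Proof.
move=> LF; elim: r => [|i r IH].
  by under eq_fun do rewrite big_nil; exact: in_L2_0.
by under eq_fun do rewrite big_cons; exact: in_L2D.
Qed.

Lemma in_LooM_L2 b f : in_Loo b -> in_L2 f -> in_L2 (fun x => b x * f x).
Proof.
move=> [mb [M bM]] Lf; have /in_L2P[mf If] := Lf.
have mbf : torus_measurable (fun x => b x * f x) by exact: torus_measurableM.
have /in_L2P[mMf IMf] := in_L2Z (M%:C) Lf.
split => //; rewrite L2norm_ltyE.
move/integrableP: IMf => [_]; apply: le_lt_trans.
under [leRHS]eq_integral do rewrite /= ger0_norm ?sqr_ge0//.
apply: ae_ge0_le_integral => //.
- by move=> x _; rewrite lee_fin sqr_ge0.
- by apply/measurable_EFinP; exact: torus_measurable_normc.
- by move=> x _; rewrite lee_fin sqr_ge0.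
- by apply/measurable_EFinP; exact: torus_measurable_normc.
- apply: filterS bM => x + Tx => /(_ Tx) bM.
  rewrite lee_fin !ComplexField.Normc.normcM !exprMn ler_wpM2r ?sqr_ge0//.
  by rewrite normc_real real_normK ?num_real// ler_sqr ?nnegrE ?normc_ge0// (le_trans (normc_ge0 _) bM).
Qed.

Lemma in_L2M_cintegrable f g : in_L2 f -> in_L2 g ->
  cintegrable (fun x => f x * g x).
Proof.
move=> /in_L2P[mf If] /in_L2P[mg Ig].
apply: (cintegrable_le (g := fun x => normc (f x) ^+ 2 + normc (g x) ^+ 2)).
- exact: torus_measurableM.
- exact: (integrableD (@measurable_torus R) If Ig).
- move=> x _; rewrite ComplexField.Normc.normcM.
  by have := normc_ge0 (f x); have := normc_ge0 (g x); nra.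
Qed.

Lemma in_Loo_bounded b (M : R) : torus_measurable b ->
  (forall x, normc (b x) <= M) -> in_Loo b.
Proof. by move=> mb bM; split => //; exists M; apply: filterE => x _. Qed.

Lemma in_Loo_L2 b : in_Loo b -> in_L2 b.
Proof.
move=> Lb; suff L1 : in_L2 (fun=> 1 : R[i]).
  have := in_LooM_L2 Lb L1.
  by under [X in in_L2 X -> _]eq_fun do rewrite mulr1.
apply/in_L2P; split; first exact: torus_measurable_cst.
apply/integrableP; split; first exact: measurable_cst.
rewrite (eq_integral (cst `|normc 1 ^+ 2|%:E))//.
rewrite (integral_cst _ (@measurable_torus R)).
by rewrite lte_mul_pinfty// ?lee_fin//; exact: torus_finite.
Qed.

Lemma inner_cintegrable f g : in_L2 f -> in_L2 g ->
  cintegrable (fun x => f x * ((g x)^*)%C).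
Proof. by move=> Lf Lg; apply: in_L2M_cintegrable => //; exact: in_L2_conj. Qed.

Lemma eq_innerl f g h : f =1 g -> inner f h = inner g h.
Proof. by move=> /funext ->. Qed.

Lemma innerDl f g h : in_L2 f -> in_L2 g -> in_L2 h ->
  inner (fun x => f x + g x) h = inner f h + inner g h.
Proof.
move=> Lf Lg Lh; rewrite /inner -mulrDr -cintegralD; [|exact: inner_cintegrable..].
by under [fun x => _]eq_fun do rewrite mulrDl.
Qed.

Lemma innerZl c f h : in_L2 f -> in_L2 h ->
  inner (fun x => c * f x) h = c * inner f h.
Proof.
move=> Lf Lh; rewrite /inner [RHS]mulrCA.
rewrite -(cintegralZ c (inner_cintegrable Lf Lh)).
by congr (_ * cintegral _); apply/funext => x; rewrite mulrA.
Qed.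

Lemma innerC f g : in_L2 f -> in_L2 g -> inner g f = ((inner f g)^*)%C.
Proof.
move=> Lf Lg; rewrite /inner conjcM conjc_real -cintegral_conj; last exact: inner_cintegrable.
by congr (_ * cintegral _); apply/funext => x; rewrite conjcM conjcK mulrC.
Qed.

Lemma innerBl f g h : in_L2 f -> in_L2 g -> in_L2 h ->
  inner (fun x => f x - g x) h = inner f h - inner g h.
Proof.
move=> Lf Lg Lh; rewrite (_ : (fun x => _) = (fun x => f x + -1 * g x)).
  by rewrite innerDl ?innerZl ?mulN1r//; exact: in_L2Z.
by apply/funext => x; rewrite mulN1r.
Qed.

Lemma innerZr c f h : in_L2 f -> in_L2 h ->
  inner h (fun x => c * f x) = (c^*)%C * inner h f.
Proof.
move=> Lf Lh; rewrite innerC ?innerZl//; last exact: in_L2Z.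
by rewrite conjcM -!innerC.
Qed.

Lemma innerBr f g h : in_L2 f -> in_L2 g -> in_L2 h ->
  inner h (fun x => f x - g x) = inner h f - inner h g.
Proof.
move=> Lf Lg Lh; rewrite innerC ?innerBl//; last exact: in_L2B.
by rewrite conjcB -!innerC.
Qed.

Lemma inner0l h : inner (fun=> 0) h = 0.
Proof.
rewrite /inner; under [fun x => _ * _]eq_fun do rewrite mul0r.
rewrite (_ : cintegral _ = 0) ?mulr0//.
by apply: complex_ext; rewrite /= /Rintegral integral0.
Qed.

Lemma inner_suml (I : Type) (r : seq I) (F : I -> torus_fun R) h :
  (forall i, in_L2 (F i)) -> in_L2 h ->
  inner (fun x => \sum_(i <- r) F i x) h = \sum_(i <- r) inner (F i) h.
Proof.
move=> LF Lh; elim: r => [|i r IH].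
  by under [fun x => _]eq_fun do rewrite big_nil; rewrite inner0l big_nil.
under [fun x => _]eq_fun do rewrite big_cons.
by rewrite innerDl ?big_cons ?IH//; exact: in_L2_sum.
Qed.

Lemma inner_ae_eq f f' g g' : in_L2 f -> in_L2 f' -> in_L2 g -> in_L2 g' ->
  torus_ae_eq f f' -> torus_ae_eq g g' -> inner f g = inner f' g'.
Proof.
move=> Lf Lf' Lg Lg' ff gg; rewrite /inner; congr (_ * _).
apply: cintegral_ae_eq.
- by apply: torus_measurableM; [case: Lf | apply: torus_measurable_conj; case: Lg].
- by apply: torus_measurableM; [case: Lf' | apply: torus_measurable_conj; case: Lg'].
- exact: (torus_ae_eq_lift2 (fun _ u v => u * (v^*)%C) ff gg).
Qed.

(** No integrability is involved: the two integrands are the same function. *)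
Lemma inner_mull b f g :
  inner (fun x => b x * f x) g = inner f (fun x => ((b x)^*)%C * g x).
Proof.
congr (_ * cintegral _); apply/funext => x.
by rewrite conjcM conjcK mulrCA mulrA.
Qed.

Lemma inner_self f : inner f f = (L2sq f)%:C.
Proof.
rewrite /inner /L2sq; under [fun x => _]eq_fun do rewrite mulcJE.
apply: complex_ext; rewrite ?ReM ?ImM /=.
- by rewrite mul0r subr0.
- by rewrite mul0r addr0 /Rintegral integral0 mulr0.
Qed.

Lemma L2sqE f : L2sq f = complex.Re (inner f f).
Proof. by rewrite inner_self. Qed.

Lemma L2sqZ c f : in_L2 f -> L2sq (fun x => c * f x) = normc c ^+ 2 * L2sq f.
Proof.
move=> Lf; apply: (@complexI R); rewrite -inner_self innerZl ?innerZr//; last exact: in_L2Z.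
by rewrite inner_self mulrA mulcJE [RHS]rmorphM.
Qed.

Lemma L2sqB f g : in_L2 f -> in_L2 g ->
  L2sq (fun x => f x - g x) = L2sq f + L2sq g - 2 * complex.Re (inner f g).
Proof.
move=> Lf Lg; have Lfg := in_L2B Lf Lg.
rewrite !L2sqE innerBl ?innerBr// (innerC Lf Lg) !(ReD, ReN) Re_conj; ring.
Qed.

Lemma L2sq_ae_eq f g : in_L2 f -> in_L2 g -> torus_ae_eq f g -> L2sq f = L2sq g.
Proof. by move=> Lf Lg fg; rewrite !L2sqE (inner_ae_eq Lf Lg Lf Lg). Qed.

Lemma L2sq_eq0 f : in_L2 f -> L2sq f = 0 -> torus_ae_eq f (fun=> 0).
Proof.
move=> Lf /eqP; have /in_L2P[mf If] := Lf.
rewrite mulf_eq0 invr_eq0 (gt_eqF (twopi_gt0 R))/= => /eqP I0.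
have : (\int[mu]_(x in T) `|(normc (f x) ^+ 2)%:E| = 0)%E.
  under eq_integral do rewrite /= ger0_norm ?sqr_ge0//.
  rewrite -[integral _ _ _]fineK; last exact: integrable_fin_num.
  by congr EFin.
move=> H; have {H} := (ae_eq_integral_abs _ (@measurable_torus R)
  (iffRL (measurable_EFinP _ _) (torus_measurable_normc mf))).1 H.
apply: filterS => x + Tx => /(_ Tx)[/eqP]; rewrite sqrf_eq0 => /eqP.
exact: ComplexField.Normc.eq0_normc.
Qed.
End L2.

(** * Fourier coefficients and partial sums *)

Section Fourier.
Variable R : realType.

Local Notation mu := (@lebesgue_measure R).
Local Notation normc := ComplexField.Normc.normc.
Local Notation T := (@torus R).

Implicit Types (f g h b : torus_fun R) (a z : R[i]) (k l : int).

(** Cauchy-Schwarz: expand the squared norm of f - d g, where d g is the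
    projection of f on the line spanned by g. *)
Lemma inner_cauchy_schwarz f g : in_L2 f -> in_L2 g ->
  normc (inner f g) ^+ 2 <= L2sq f * L2sq g.
Proof.
move=> Lf Lg; have [g0|g0] := eqVneq (L2sq g) 0.
  have L0 := @in_L2_0 R.
  rewrite (inner_ae_eq Lf Lf Lg L0 (torus_ae_eq_refl f) (L2sq_eq0 Lg g0)).
  by rewrite innerC// inner0l conjc0 ComplexField.Normc.normc0 expr0n g0 mulr0.
have gp : 0 < L2sq g by rewrite lt_neqAle eq_sym g0 L2sq_ge0.
set c := inner f g; pose d := ((L2sq g)^-1)%:C * c.
have Ldg : in_L2 (fun x => d * g x) by exact: in_L2Z.
have := L2sq_ge0 (fun x => f x - d * g x).
rewrite L2sqB// L2sqZ// innerZr// -/c /d ComplexField.Normc.normcM normc_real.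
rewrite conjcM conjc_real -mulrA [(c^*)%C * c]mulrC mulcJE.
rewrite (_ : complex.Re _ = (L2sq g)^-1 * normc c ^+ 2); last first.
  by move: (normc c ^+ 2) => y; rewrite ReM /= mul0r subr0.
rewrite ger0_norm ?invr_ge0 ?(ltW gp)// => H.
have : 0 <= (L2sq f - normc c ^+ 2 / L2sq g) * L2sq g.
  rewrite mulr_ge0 ?(ltW gp)//; apply: le_trans H _.
  rewrite le_eqVlt; apply/orP; left; apply/eqP; field.
  exact: g0.
by rewrite mulrBl divfK// subr_ge0.
Qed.

Lemma cexpE k (x : R) : cexp k x = cos (k%:~R * x) +i* sin (k%:~R * x).
Proof. by []. Qed.

Lemma cexpD k l (x : R) : cexp (k + l) x = cexp k x * cexp l x.
Proof.
by apply: complex_ext; rewrite ?ReM ?ImM /= intrD mulrDl ?cosD ?sinD//;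
  rewrite addrC mulrC.
Qed.

Lemma cexp0 (x : R) : cexp 0 x = 1.
Proof. by rewrite cexpE mul0r cos0 sin0. Qed.

Lemma cexp_conj k (x : R) : ((cexp k x)^*)%C = cexp (- k) x.
Proof. by rewrite !cexpE /= mulrNz mulNr cosN sinN. Qed.

Lemma normc_cexp k (x : R) : normc (cexp k x) = 1.
Proof. by rewrite /= cos2Dsin2 sqrtr1. Qed.

Lemma continuous_scaled (F : R -> R) (c : R) : continuous F ->
  continuous (fun x => F (c * x)).
Proof.
move=> cF x; apply: (@continuous_comp _ _ _ (fun x => c * x) F); last exact: cF.
by apply: cvgM; [exact: cvg_cst | exact: cvg_id].
Qed.

Lemma torus_measurable_cexp k : torus_measurable (cexp k : torus_fun R).
Proof.
by split; apply: measurable_funTS; apply: continuous_measurable_fun;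
  apply: continuous_scaled; [exact: continuous_cos | exact: continuous_sin].
Qed.

Lemma in_Loo_cexp k : in_Loo (cexp k : torus_fun R).
Proof.
apply: (in_Loo_bounded (M := 1)); first exact: torus_measurable_cexp.
by move=> x; rewrite normc_cexp.
Qed.

Lemma in_L2_cexp k : in_L2 (cexp k : torus_fun R).
Proof. exact: in_Loo_L2 (in_Loo_cexp k). Qed.

Lemma torus_FTC2 (F f : R -> R) : continuous f ->
  (forall x : R, is_derive x 1 F (f x)) ->
  \int[mu]_(x in T) f x = F (2 * pi) - F 0.
Proof.
move=> cf dF; have cF : continuous F.
  by move=> x; apply: differentiable_continuous; apply/derivable1_diffP; exact: ex_derive.
rewrite /Rintegral (continuous_FTC2 (F := F)) ?twopi_gt0//.
- exact: continuous_subspaceT.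
- split; first by move=> x _; exact: ex_derive.
  + by apply: cvg_at_right_filter; exact: cF.
  + by apply: cvg_at_left_filter; exact: cF.
- by move=> x _; rewrite derive1E; exact: derive_val.
Qed.

Lemma sin_2piM k : sin (k%:~R * (2 * pi)) = 0 :> R.
Proof.
have n0 (n : nat) : sin (n%:R * (2 * pi)) = 0 :> R.
  by rewrite -[X in sin X]add0r !mulr_natl (periodicn (@sinD2pi R)) sin0.
by case: k => n; rewrite ?NegzE ?mulrNz ?mulNr ?sinN ?pmulrn n0 ?oppr0.
Qed.

Lemma cos_2piM k : cos (k%:~R * (2 * pi)) = 1 :> R.
Proof.
have n0 (n : nat) : cos (n%:R * (2 * pi)) = 1 :> R.
  by rewrite -[X in cos X]add0r !mulr_natl (periodicn (@cosD2pi R)) cos0.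
by case: k => n; rewrite ?NegzE ?mulrNz ?mulNr ?cosN ?pmulrn n0.
Qed.

Lemma cintegral_cexp k :
  cintegral (cexp k : torus_fun R) = if k == 0 then (2 * pi)%:C else 0.
Proof.
case: eqVneq => [->|k0].
  apply: complex_ext => /=.
  - under eq_Rintegral do rewrite mul0r cos0.
    rewrite (torus_FTC2 (F := id)) ?subr0//; first exact: cst_continuous.
  - under eq_Rintegral do rewrite mul0r sin0.
    by rewrite /Rintegral integral0.
have kR0 : k%:~R != 0 :> R by rewrite intr_eq0.
have dk (x : R) : is_derive x 1 ( *%R k%:~R : R -> R) k%:~R.
  apply: is_derive_eq (is_deriveZ k%:~R (is_derive_id x 1)) _.
  by rewrite -[LHS]/(_ * _) mulr1.
apply: complex_ext => /=.
- have dF (x : R) : is_derive x 1 (k%:~R^-1 *: (sin \o *%R k%:~R)) (cos (k%:~R * x)).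
    apply: is_derive_eq (is_deriveZ _ (is_derive1_comp (is_derive_sin _) (dk x))) _.
    by rewrite -[LHS]/(_ * _) mulrCA mulVf ?mulr1.
  rewrite (torus_FTC2 _ dF); last exact/continuous_scaled/continuous_cos.
  rewrite -[LHS]/(k%:~R^-1 * sin (k%:~R * (2 * pi)) - k%:~R^-1 * sin (k%:~R * 0)).
  by rewrite sin_2piM !mulr0 sin0 mulr0 subrr.
- have dF (x : R) : is_derive x 1 ((- k%:~R^-1) *: (cos \o *%R k%:~R)) (sin (k%:~R * x)).
    apply: is_derive_eq (is_deriveZ _ (is_derive1_comp (is_derive_cos _) (dk x))) _.
    by rewrite -[LHS]/(_ * _) mulrCA mulNr mulNr mulrN opprK mulVf ?mulr1.
  rewrite (torus_FTC2 _ dF); last exact/continuous_scaled/continuous_sin.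
  rewrite -[LHS]/(- k%:~R^-1 * cos (k%:~R * (2 * pi)) - - k%:~R^-1 * cos (k%:~R * 0)).
  by rewrite cos_2piM !mulr0 cos0 subrr.
Qed.

Lemma inner_cexp k l : inner (cexp k : torus_fun R) (cexp l) = (k == l)%:R.
Proof.
rewrite /inner; have -> : (fun x => cexp k x * ((cexp l x)^*)%C) = cexp (k - l) :> torus_fun R.
  by apply/funext => x; rewrite cexp_conj cexpD.
rewrite cintegral_cexp subr_eq0; case: eqP => _; last by rewrite mulr0.
by rewrite -rmorphM/= mulVf// gt_eqF// twopi_gt0.
Qed.

(** An enumeration 0, -1, 1, -2, 2, ... of the frequencies, which turns sums
    over the integers into series. *)
Definition freq (n : nat) : int := if odd n then Negz n./2 else Posz n./2.

Definition freq_index k : nat :=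
  match k with Posz m => m.*2 | Negz m => m.*2.+1 end.

Lemma freqK : cancel freq freq_index.
Proof.
move=> n; rewrite /freq -[in RHS](odd_double_half n).
by case: (odd n).
Qed.

Lemma freq_indexK : cancel freq_index freq.
Proof.
case=> n; rewrite /freq /=; first by rewrite odd_double doubleK.
by rewrite odd_double /= uphalf_double.
Qed.

Lemma freq_inj : injective freq. Proof. exact: can_inj freqK. Qed.

Definition trig_sum (c : nat -> R[i]) (r : seq nat) : torus_fun R :=
  fun x => \sum_(n <- r) c n * cexp (freq n) x.

Lemma in_L2_mode a k : in_L2 (fun x => a * cexp k x : R[i]).
Proof. exact: in_L2Z (in_L2_cexp k). Qed.

Lemma in_L2_trig_sum c r : in_L2 (trig_sum c r).
Proof. by apply: in_L2_sum => n; exact: in_L2_mode. Qed.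

Lemma inner_trig_sum c r g : in_L2 g ->
  inner (trig_sum c r) g = \sum_(n <- r) c n * inner (cexp (freq n)) g.
Proof.
move=> Lg; rewrite inner_suml//; last by move=> n; exact: in_L2_mode.
by apply: eq_bigr => n _; rewrite innerZl//; exact: in_L2_cexp.
Qed.

Lemma fourier_trig_sum c r m : uniq r ->
  fourier (trig_sum c r) (freq m) = if m \in r then c m else 0.
Proof.
move=> ur; rewrite /fourier inner_trig_sum; last exact: in_L2_cexp.
under eq_bigr do rewrite inner_cexp (inj_eq freq_inj).
case: ifPn => mr.
  rewrite (bigD1_seq m)//= eqxx mulr1 big1 ?addr0// => n nm.
  by rewrite (negbTE nm) mulr0.
rewrite big_seq big1// => n nr; case: eqP => [nm|]; last by rewrite mulr0.
by move: mr; rewrite -nm nr.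
Qed.

Lemma L2sq_trig_sum c r : uniq r ->
  L2sq (trig_sum c r) = \sum_(n <- r) normc (c n) ^+ 2.
Proof.
move=> ur; apply: (@complexI R); rewrite -inner_self inner_trig_sum; last exact: in_L2_trig_sum.
rewrite rmorph_sum/= !(big_seq _ _ r); apply: eq_bigr => n nr.
rewrite innerC; [|exact: in_L2_trig_sum|exact: in_L2_cexp].
by rewrite -/(fourier _ _) fourier_trig_sum// nr mulcJE.
Qed.

Lemma L2sqB_trig_sum f r : in_L2 f -> uniq r ->
  L2sq (fun x => f x - trig_sum (fun n => fourier f (freq n)) r x) =
  L2sq f - \sum_(n <- r) normc (fourier f (freq n)) ^+ 2.
Proof.
move=> Lf ur; rewrite L2sqB//; last exact: in_L2_trig_sum.
rewrite L2sq_trig_sum// (innerC (in_L2_trig_sum _ _) Lf) Re_conj inner_trig_sum//.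
rewrite (_ : \sum_(n <- r) _ = (\sum_(n <- r) normc (fourier f (freq n)) ^+ 2)%:C) /=; first by ring.
rewrite rmorph_sum/=; apply: eq_bigr => n _.
by rewrite (innerC Lf (in_L2_cexp _)) -/(fourier _ _) mulcJE.
Qed.

Lemma bessel f r : in_L2 f -> uniq r ->
  \sum_(n <- r) normc (fourier f (freq n)) ^+ 2 <= L2sq f.
Proof. by move=> Lf ur; rewrite -subr_ge0 -L2sqB_trig_sum//; exact: L2sq_ge0. Qed.

End Fourier.

(** * Completeness of L^2 *)

Section RieszFischer.
Variable R : realType.

Local Notation mu := (@lebesgue_measure R).
Local Notation normc := ComplexField.Normc.normc.
Local Notation T := (@torus R).

Implicit Types (f g h : torus_fun R).

Definition torus_ae_cvg (p : nat -> torus_fun R) g :=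
  {ae mu, forall x, T x ->
    (complex.Re (p n x) @[n --> \oo] --> complex.Re (g x)) /\
    (complex.Im (p n x) @[n --> \oo] --> complex.Im (g x))}.

Lemma limn_einf_le (v : nat -> \bar R) (m0 : nat) (B : \bar R) :
  (forall m, (m0 <= m)%N -> (v m <= B)%E) -> (limn_einf v <= B)%E.
Proof.
move=> vB; rewrite limn_einf_lim; apply: lime_le; first exact: is_cvg_einfs.
apply: nearW => n; apply: (@le_trans _ _ (v (maxn n m0))).
  by apply: ereal_inf_lbound; exists (maxn n m0) => //=; rewrite leq_maxl.
by apply: vB; rewrite leq_maxr.
Qed.

Lemma integral_normc_sq f : in_L2 f ->
  (\int[mu]_(x in T) (normc (f x) ^+ 2)%:E)%E = (2 * pi * L2sq f)%:E.
Proof.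
move=> /in_L2P[mf If]; rewrite /L2sq mulrA divff ?gt_eqF ?twopi_gt0// mul1r.
by rewrite fineK//; exact: integrable_fin_num.
Qed.

(** Balls of L^2 are closed under almost everywhere convergence, by Fatou's
    lemma. *)
Lemma L2sq_fatou (p : nat -> torus_fun R) g (m0 : nat) (B : R) :
  (forall n, in_L2 (p n)) -> torus_measurable g -> torus_ae_cvg p g ->
  (forall m, (m0 <= m)%N -> L2sq (p m) <= B) -> in_L2 g /\ L2sq g <= B.
Proof.
move=> Lp mg pg pB.
have mnp n : measurable_fun T (fun x : measurableTypeR R => (normc (p n x) ^+ 2)%:E).
  by apply/measurable_EFinP; apply: torus_measurable_normc; case: (Lp n).
have mng := torus_measurable_normc mg.
have Ig : (\int[mu]_(x in T) (normc (g x) ^+ 2)%:E <= (2 * pi * B)%:E)%E.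
  rewrite (ae_eq_integral (fun x : measurableTypeR R => limn_einf (fun n => (normc (p n x) ^+ 2)%:E))) //.
  - apply: le_trans (fatou _ _ _ _) _ => //.
      by move=> n x _; rewrite lee_fin sqr_ge0.
    apply: (limn_einf_le (m0 := m0)) => m m0m.
    by rewrite integral_normc_sq// lee_fin ler_wpM2l ?pB// ltW// twopi_gt0.
  - exact/measurable_EFinP.
  - under eq_fun do rewrite limn_einf_lim.
    apply: (@emeasurable_fun_cvg _ (measurableTypeR R) R T
      (fun n x => einfs (fun n => (normc (p n x) ^+ 2)%:E) n)).
      by move=> n; exact: (@measurable_fun_einfs _ (measurableTypeR R) R T
        (fun n x => (normc (p n x) ^+ 2)%:E) mnp n).
    by move=> x _; exact: is_cvg_einfs.
  - apply: filterS pg => x + Tx => /(_ Tx)[Rx Ix].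
    apply/esym; apply: (cvg_limn_einf_sup _).1.
    apply: cvg_EFin; first exact: nearW.
    rewrite /comp/=; under eq_fun do rewrite sqr_normcE; rewrite sqr_normcE.
    by apply: cvgD; rewrite expr2; under eq_fun do rewrite expr2; exact: cvgM.
have Lg : in_L2 g.
  by split => //; rewrite L2norm_ltyE (le_lt_trans Ig)// ltry.
split=> //; move: Ig; rewrite integral_normc_sq// lee_fin.
by rewrite ler_pM2l// twopi_gt0.
Qed.

Lemma cvg_geometric_increments (q : nat -> R) (C : R) :
  (forall n, `|q n.+1 - q n| <= C / 2 ^+ n) -> cvgn q.
Proof.
move=> qC; have C0 : 0 <= C.
  by have := le_trans (normr_ge0 _) (qC 0); rewrite expr0 divr1.
have : cvgn (series (telescope q)).
  apply: normed_cvg.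
  apply: (@series_le_cvg _ _ (geometric C 2^-1)) => //.
  - by move=> n; exact: normr_ge0.
  - by move=> n /=; rewrite mulr_ge0// exprn_ge0// invr_ge0.
  - by move=> n /=; rewrite exprVn qC.
  - by apply: is_cvg_geometric_series; rewrite ger0_norm ?invr_ge0// invf_lt1// ltr1n.
rewrite telescopeK => c; have -> : q = [sequence q n - q 0 + q 0]_n.
  by apply/funext => n /=; rewrite subrK.
by apply: is_cvgD => //; exact: is_cvg_cst.
Qed.

(** If the increments of a sequence are geometrically small in L^2, then the sum
    of their squares with growing weights is integrable, hence finite almost
    everywhere; at such a point the increments are geometrically small. *)
Lemma L2_fast_cauchy_ae_cvg (p : nat -> torus_fun R) :
  (forall n, in_L2 (p n)) ->
  (forall n, L2sq (fun x => p n.+1 x - p n x) <= 8^-1 ^+ n) ->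
  exists2 g, torus_measurable g & torus_ae_cvg p g.
Proof.
move=> Lp pB; pose D n x := p n.+1 x - p n x.
have LD n : in_L2 (D n) by exact: in_L2B.
pose t n x : \bar R := (4 ^+ n * normc (D n x) ^+ 2)%:E.
have t0 n (x : R) : (0 <= t n x)%E .
  rewrite lee_fin; apply: mulr_ge0; [exact: exprn_ge0 | exact: sqr_ge0].
have mt n : measurable_fun T (t n : measurableTypeR R -> \bar R).
  apply/measurable_EFinP; apply: measurable_funM; first exact: measurable_cst.
  by apply: torus_measurable_normc; case: (LD n).
pose F x := (\sum_(0 <= n <oo) t n x)%E.
have F0 x : (0 <= F x)%E by apply: nneseries_ge0 => n _ _.
have mF : measurable_fun T (F : measurableTypeR R -> \bar R).
  by apply: (@ge0_emeasurable_sum _ (measurableTypeR R) R T t xpredT) => *;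
    [exact: t0 | exact: mt].
have IF : (\int[mu]_(x in T) F x < +oo)%E.
  rewrite integral_nneseries//.
  apply: (@le_lt_trans _ _ (4 * pi)%:E); last exact: ltry.
  have gs := cvg_geometric_eseries_half (r := 4 * pi : R) (n := 0).
  rewrite expr0 divr1 in gs; rewrite -(cvg_lim _ gs)//.
  apply: lee_nneseries => [n _|n].
    by move=> _; apply: integral_ge0 => x _; exact: t0.
  rewrite /t; under eq_integral do rewrite EFinM.
  rewrite ge0_integralZl_EFin ?exprn_ge0//.
  - rewrite integral_normc_sq// -EFinM lee_fin => _.
    apply: (@le_trans _ _ (4 ^+ n * (2 * pi * 8^-1 ^+ n))).
      by rewrite ler_wpM2l ?exprn_ge0// ler_wpM2l ?pB// ltW// twopi_gt0.
    rewrite addn1 natrX exprS invfM -exprVn.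
    rewrite (_ : 2^-1 ^+ n = 4 ^+ n * 8^-1 ^+ n :> R); last first.
      by rewrite -exprMn; congr (_ ^+ _); lra.
    by rewrite le_eqVlt; apply/orP; left; apply/eqP; field.
  - by move=> x _; rewrite lee_fin sqr_ge0.
  - by apply/measurable_EFinP; apply: torus_measurable_normc; case: (LD n).
pose A : set R := T `&` [set x | (F x < +oo)%E].
have mA : @measurable _ (measurableTypeR R) A.
  by apply: emeasurable_fun_infty_o.
have Acvg x : A x -> cvgn (fun n => complex.Re (p n x)) /\ cvgn (fun n => complex.Im (p n x)).
  move=> [Tx /= Fx]; pose C := Num.sqrt (fine (F x)).
  have DC n : normc (D n x) <= C / 2 ^+ n.
    have FK : F x = (fine (F x))%:E by rewrite fineK// ge0_fin_numE.
    have : (t n x <= F x)%E.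
      rewrite /F (nneseries_split 0 n.+1)// add0n big_nat_recr//= -addeA addeC -addeA.
      by rewrite leeDl// adde_ge0// ?nneseries_ge0// sume_ge0.
    rewrite FK lee_fin => tF; rewrite ler_pdivlMr ?exprn_gt0//.
    rewrite -[leLHS]ger0_norm ?mulr_ge0 ?normc_ge0 ?exprn_ge0// -sqrtr_sqr.
    apply: ler_wsqrtr; apply: le_trans tF.
    rewrite exprMn mulrC exprAC (_ : 2 ^+ 2 = 4)//; ring.
  split; apply: (cvg_geometric_increments (C := C)) => n.
  - by rewrite -ReN -ReD (le_trans (normr_Re_le _))// DC.
  - by rewrite -ImN -ImD (le_trans (normr_Im_le _))// DC.
pose lr x := lim ((complex.Re (p n x) * \1_A x) @[n --> \oo]).
pose li x := lim ((complex.Im (p n x) * \1_A x) @[n --> \oo]).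
have cr x : (complex.Re (p n x) * \1_A x) @[n --> \oo] --> lr x.
  rewrite /lr indicE; case: (boolP (x \in A)) => [/set_mem /Acvg[c _]|_].
    by under eq_fun do rewrite mulr1.
  by under eq_fun do rewrite mulr0; exact: is_cvg_cst.
have ci x : (complex.Im (p n x) * \1_A x) @[n --> \oo] --> li x.
  rewrite /li indicE; case: (boolP (x \in A)) => [/set_mem /Acvg[_ c]|_].
    by under eq_fun do rewrite mulr1.
  by under eq_fun do rewrite mulr0; exact: is_cvg_cst.
exists (fun x => lr x +i* li x).
  apply/torus_measurableE; split => /=.
  - apply: (@measurable_fun_cvg _ (measurableTypeR R) R T
      (fun n x => complex.Re (p n x) * \1_A x)) => // n.
    apply: measurable_funM; last exact: measurable_indic.
    by case: (Lp n) => /torus_measurableE[].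
  - apply: (@measurable_fun_cvg _ (measurableTypeR R) R T
      (fun n x => complex.Im (p n x) * \1_A x)) => // n.
    apply: measurable_funM; last exact: measurable_indic.
    by case: (Lp n) => /torus_measurableE[].
have iF : mu.-integrable T F.
  apply/integrableP; split => //.
  by under eq_integral do rewrite gee0_abs//.
apply: filterS (integrable_ae (@measurable_torus R) iF) => x + Tx => /(_ Tx) Fx /=.
have xA : x \in A by apply/mem_set; split => //=; rewrite -ge0_fin_numE.
have := ci x; have := cr x; rewrite indicE xA.
by under eq_fun do rewrite mulr1; move=> ?; under eq_fun do rewrite mulr1.
Qed.

(** Along a fast subsequence the partial sums converge almost everywhere to some
    g; Fatou's lemma, applied to this subsequence minus a fixed partial sum,
    bounds the distance from g to that partial sum by the tail of the series. *)
Theorem riesz_fischer (c : nat -> R[i]) (B : R) :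
  (forall N, \sum_(n <- iota 0 N) normc (c n) ^+ 2 <= B) ->
  exists2 g, in_L2 g &
    L2sq (fun x => g x - trig_sum c (iota 0 N) x) @[N --> \oo] --> (0 : R).
Proof.
move=> cB; pose a N := \sum_(n <- iota 0 N) normc (c n) ^+ 2.
pose S N := trig_sum c (iota 0 N).
have aD m n : (m <= n)%N -> a n = a m + \sum_(i <- iota m (n - m)) normc (c i) ^+ 2.
  by move=> mn; rewrite /a -{1}(subnKC mn) iotaD big_cat.
have SD m n (x : R) : (m <= n)%N -> S n x - S m x = trig_sum c (iota m (n - m)) x.
  move=> mn; rewrite /S /trig_sum -{1}(subnKC mn) iotaD big_cat/=.
  by rewrite addrAC subrr add0r.
have LS N : in_L2 (S N) by exact: in_L2_trig_sum.
have aS m n : (m <= n)%N -> L2sq (fun x => S n x - S m x) = a n - a m.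
  move=> mn; rewrite (_ : (fun x => _) = trig_sum c (iota m (n - m))).
    by rewrite L2sq_trig_sum ?iota_uniq// (aD _ _ mn) addrAC subrr add0r.
  by apply/funext => x; exact: SD.
have a_nd : {homo a : m n / (m <= n)%N >-> m <= n}.
  by move=> m n mn; rewrite (aD _ _ mn) lerDl sumr_ge0// => i _; rewrite sqr_ge0.
have ca : cvgn a.
  by apply: nondecreasing_is_cvgn => //; exists B => _ [N _ <-]; exact: cB.
have a_le n : a n <= limn a by exact: nondecreasing_cvgn_le.
have [N0 N0P] : {N : nat -> nat & forall j n, (N j <= n)%N -> limn a - a n <= 8^-1 ^+ j}.
  apply: (@choice nat nat (fun j N => forall n, (N <= n)%N -> limn a - a n <= 8^-1 ^+ j)) => j.
  have /cvgrPdist_le := ca.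
  move=> /(_ (8^-1 ^+ j)) [|N _ NP]; first by rewrite exprn_gt0// invr_gt0.
  by exists N => n /NP; apply: le_trans; exact: ler_norm.
pose N j := \max_(i < j.+1) N0 i.
have NP j n : (N j <= n)%N -> limn a - a n <= 8^-1 ^+ j.
  by move=> jn; apply: N0P; apply: leq_trans jn; exact: (leq_bigmax (ord_max : 'I_j.+1)).
have N_nd j : (N j <= N j.+1)%N by rewrite {2}/N big_ord_recr/= leq_maxl.
have N_homo : {homo N : i j / (i <= j)%N >-> (i <= j)%N}.
  by apply: homo_leq => //; exact: leq_trans.
have [|j|g mg cg] := @L2_fast_cauchy_ae_cvg (fun j => S (N j)); first by [].
  rewrite aS// (le_trans _ (NP j (N j) (leqnn _)))// lerB//.
have SB n j : (N j <= n)%N -> in_L2 (fun x => g x - S n x) /\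
    L2sq (fun x => g x - S n x) <= 8^-1 ^+ j.
  move=> jn; apply: (@L2sq_fatou (fun m x => S (N m) x - S n x) _ j).
  - by move=> m; exact: in_L2B.
  - by apply: torus_measurableB => //; case: (LS n).
  - apply: filterS cg => x + Tx => /(_ Tx)[c1 c2]; rewrite !(ReD, ReN, ImD, ImN).
    by split; [under eq_fun do rewrite ReD ReN | under eq_fun do rewrite ImD ImN];
      apply: cvgD => //; exact: cvg_cst.
  - move=> m jm; have [nm|/ltnW mn] := leqP n (N m).
      by rewrite aS// (le_trans _ (NP j n jn))// lerB.
    rewrite (_ : L2sq _ = L2sq (fun x => S n x - S (N m) x)).
      rewrite aS// (le_trans _ (NP j (N m) (N_homo _ _ jm)))// lerB//.
    rewrite (_ : (fun x => S (N m) x - S n x) = (fun x => -1 * (S n x - S (N m) x))).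
      rewrite L2sqZ; last exact: in_L2B.
      by rewrite sqr_normcE ReN ImN /= oppr0 expr0n addr0 sqrrN expr1n mul1r.
    by apply/funext => x; rewrite mulN1r opprB.
have Lg : in_L2 g.
  have [/(in_L2D (LS (N 0%N))) + _] := SB (N 0%N) 0%N (leqnn _).
  by under [X in in_L2 X -> _]eq_fun do rewrite addrC subrK.
exists g => //.
apply/cvgrPdist_le => e e0.
have [j je] : exists j : nat, 8^-1 ^+ j <= e.
  have /cvgrPdist_le : (8^-1 : R) ^+ n @[n --> \oo] --> (0 : R).
    by apply: cvg_expr; rewrite ger0_norm ?invr_ge0// invf_lt1// ltr1n.
  move=> /(_ e e0) [j _ /(_ j (leqnn _))].
  by rewrite sub0r normrN ger0_norm ?exprn_ge0 ?invr_ge0//; exists j.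
exists (N j) => // n /= jn; rewrite sub0r normrN ger0_norm ?L2sq_ge0//.
exact: le_trans (SB n j jn).2 je.
Qed.

End RieszFischer.

(** * Completeness of the trigonometric system *)

Section TrigCompleteness.
Variable R : realType.

Local Notation mu := (@lebesgue_measure R).
Local Notation normc := ComplexField.Normc.normc.
Local Notation T := (@torus R).

Implicit Types (f g h p q : torus_fun R) (k l : int).

Lemma in_LooD p q : in_Loo p -> in_Loo q -> in_Loo (fun x => p x + q x).
Proof.
move=> [mp [M pM]] [mq [N qN]]; split; first exact: torus_measurableD.
exists (M + N); apply: filterS2 pM qN => x /[swap] + /[swap] Tx.
move=> /(_ Tx) qN /(_ Tx) pM.
by rewrite (le_trans (le_normcD _ _))// lerD.
Qed.

Lemma in_Loo_cst (c : R[i]) : in_Loo (fun=> c : R[i]).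
Proof. by apply: (in_Loo_bounded (M := normc c)) => //; exact: torus_measurable_cst. Qed.

Lemma in_LooM p q : in_Loo p -> in_Loo q -> in_Loo (fun x => p x * q x).
Proof.
move=> [mp [M pM]] [mq [N qN]]; split; first exact: torus_measurableM.
exists (M * N); apply: filterS2 pM qN => x /[swap] + /[swap] Tx.
move=> /(_ Tx) qN /(_ Tx) pM.
by rewrite ComplexField.Normc.normcM ler_pM ?normc_ge0.
Qed.

Lemma in_LooZ (c : R[i]) p : in_Loo p -> in_Loo (fun x => c * p x).
Proof. by move=> Lp; apply: in_LooM => //; exact: in_Loo_cst. Qed.

Lemma in_Loo_conj p : in_Loo p -> in_Loo (fun x => ((p x)^*)%C).
Proof.
move=> [mp [M pM]]; split; first exact: torus_measurable_conj.
by exists M; apply: filterS pM => x pM Tx; rewrite normc_conj pM.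
Qed.

Lemma in_L2M_Loo f p : in_L2 f -> in_Loo p -> in_L2 (fun x => f x * p x).
Proof.
move=> Lf Lp; have := in_LooM_L2 Lp Lf.
by under [X in in_L2 X -> _]eq_fun do rewrite mulrC.
Qed.

Section Annihilator.
Variable f : torus_fun R.
Hypothesis Lf : in_L2 f.

(** The point of quantifying over all k is stability under multiplication by
    exponentials, hence by trigonometric polynomials. *)
Definition annihilates p :=
  in_Loo p /\ forall k, fourier (fun x => p x * f x) k = 0.

Lemma annihilatesD p q : annihilates p -> annihilates q ->
  annihilates (fun x => p x + q x).
Proof.
move=> [Lp p0] [Lq q0]; split; first exact: in_LooD.
move=> k; have := q0 k; have := p0 k; rewrite /fourier.
have -> : (fun x => (p x + q x) * f x) = (fun x => p x * f x + q x * f x).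
  by apply/funext => x; rewrite mulrDl.
move=> p0k q0k; rewrite innerDl ?p0k ?q0k ?addr0//;
  [exact: in_LooM_L2..|exact: in_L2_cexp].
Qed.

Lemma annihilatesZ c p : annihilates p -> annihilates (fun x => c * p x).
Proof.
move=> [Lp p0]; split; first exact: in_LooZ.
move=> k; have := p0 k; rewrite /fourier.
have -> : (fun x => c * p x * f x) = (fun x => c * (p x * f x)).
  by apply/funext => x; rewrite mulrA.
move=> p0k; rewrite innerZl ?p0k ?mulr0//; [exact: in_LooM_L2|exact: in_L2_cexp].
Qed.

Lemma annihilates_cexp l p : annihilates p -> annihilates (fun x => cexp l x * p x).
Proof.
move=> [Lp p0]; split; first by apply: in_LooM => //; exact: in_Loo_cexp.
move=> k; rewrite /fourier.
have -> : (fun x => cexp l x * p x * f x) = (fun x => cexp l x * (p x * f x)).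
  by apply/funext => x; rewrite mulrA.
rewrite (inner_mull (cexp l)).
have -> : (fun x => ((cexp l x)^*)%C * cexp k x) = cexp (k - l) :> torus_fun R.
  by apply/funext => x; rewrite cexp_conj -cexpD addrC.
exact: p0.
Qed.

(** A trigonometric polynomial with values in [0, 1] which, for x and b strictly
    between 0 and 2 pi, exceeds 1/2 exactly when x < b. *)
Definition step (b x : R) : R := 2^-1 + sin (x / 2) * sin ((b - x) / 2) / 2.

Lemma stepE b x : step b x = 2^-1 + (cos (x - b / 2) - cos (b / 2)) / 4.
Proof.
have -> : x - b / 2 = x / 2 - (b - x) / 2 by field.
have -> : b / 2 = x / 2 + (b - x) / 2 by field.
by rewrite cosB cosD /step; field.
Qed.

Lemma annihilates_step b p : annihilates p ->
  annihilates (fun x => (step b x)%:C * p x).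
Proof.
move=> Ap; pose z := (cos (b / 2) -i* sin (b / 2)) * (8^-1)%:C.
have := annihilatesD (annihilatesZ (2^-1 - cos (b / 2) / 4)%:C Ap)
  (annihilatesD (annihilatesZ z (annihilates_cexp 1 Ap))
    (annihilatesZ (z^*)%C (annihilates_cexp (- 1) Ap))).
congr annihilates; apply/funext => x.
rewrite !mulrA -!mulrDl; congr (_ * _); rewrite stepE cosB !cexpE.
by apply: complex_ext;
  rewrite !(ReD, ReM, ImD, ImM) /= !(mul1r, mulN1r) cosN sinN; field.
Qed.

Lemma annihilates_stepX b n p : annihilates p ->
  annihilates (fun x => (step b x ^+ n)%:C * p x).
Proof.
move=> Ap; elim: n => [|n IH].
  by move: Ap; congr annihilates; apply/funext => x; rewrite expr0 mul1r.
move: (annihilates_step b IH); congr annihilates; apply/funext => x.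
by rewrite exprS rmorphM mulrA.
Qed.

Lemma annihilates_onemX b n m p : annihilates p ->
  annihilates (fun x => ((1 - step b x ^+ n) ^+ m)%:C * p x).
Proof.
move=> Ap; elim: m => [|m IH].
  by move: Ap; congr annihilates; apply/funext => x; rewrite expr0 mul1r.
have := annihilatesD IH (annihilatesZ (-1) (annihilates_stepX b n IH)).
congr annihilates; apply/funext => x.
rewrite exprS mulrBl mul1r rmorphB rmorphM /=; ring.
Qed.

(** The polynomials 1 - (1 - y^n)^(2^n), familiar from the proof of the
    Stone-Weierstrass theorem, push [0, 1/2) to 0 and (1/2, 1] to 1 while staying
    between 0 and 1. Composed with [step b] they approximate boundedly the
    indicator function of x < b. *)
Definition bump (b : R) (n : nat) (x : R) : R := 1 - (1 - step b x ^+ n) ^+ (2 ^ n).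

Lemma annihilates_bump b n : (forall k, fourier f k = 0) ->
  annihilates (fun x => (bump b n x)%:C).
Proof.
move=> f0; have A1 : annihilates (fun=> 1).
  split; first exact: in_Loo_cst.
  by move=> k; under [X in fourier X]eq_fun do rewrite mul1r.
have := annihilatesD A1 (annihilatesZ (-1) (annihilates_onemX b n (2 ^ n) A1)).
congr annihilates; apply/funext => x.
by rewrite /bump rmorphB /= mulr1 mulN1r.
Qed.

End Annihilator.

Lemma bernoulli_le (a : R) m : -1 <= a -> 1 + m%:R * a <= (1 + a) ^+ m.
Proof.
move=> a1; elim: m => [|m IH]; first by rewrite mul0r addr0 expr0.
rewrite exprS; apply: (@le_trans _ _ ((1 + a) * (1 + m%:R * a))); last first.
  by rewrite ler_wpM2l// -lerBlDl sub0r.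
rewrite -natr1; have : 0 <= m%:R * a ^+ 2 by rewrite mulr_ge0 ?sqr_ge0.
by nra.
Qed.

Lemma pow_step_bounds (y : R) n : 0 <= y <= 1 ->
  0 <= 1 - (1 - y ^+ n) ^+ (2 ^ n) <= 1.
Proof.
move=> /andP[y0 y1]; have yn0 : 0 <= y ^+ n by exact: exprn_ge0.
have yn1 : y ^+ n <= 1 by exact: exprn_ile1.
rewrite subr_ge0 exprn_ile1 ?subr_ge0//= ?lerBlDr ?lerDl//.
by rewrite exprn_ge0// subr_ge0.
Qed.

(** Bernoulli: (1 - y^n)^(2^n) >= 1 - (2y)^n. *)
Lemma pow_step_lt (y : R) : 0 <= y < 2^-1 ->
  1 - (1 - y ^+ n) ^+ (2 ^ n) @[n --> \oo] --> (0 : R).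
Proof.
move=> /andP[y0 y1]; have y1' : y <= 1 by lra.
apply: (@squeeze_cvgr _ _ _ _ (cst 0) (fun n => (2 * y) ^+ n)).
- apply: nearW => n; have /andP[-> _] := pow_step_bounds n (introT andP (conj y0 y1')).
  rewrite /= exprMn -natrX lerBlDr -lerBlDl.
  have := @bernoulli_le (- y ^+ n) (2 ^ n); rewrite mulrN; apply.
  by rewrite lerN2 exprn_ile1.
- exact: cvg_cst.
- by apply: cvg_expr; rewrite ger0_norm ?mulr_ge0//; lra.
Qed.

(** Here (1 - a)^m (1 + a)^m <= 1 with a = y^n and m = 2^n, and the second factor
    is at least (2y)^n by Bernoulli. *)
Lemma pow_step_gt (y : R) : 2^-1 < y <= 1 ->
  1 - (1 - y ^+ n) ^+ (2 ^ n) @[n --> \oo] --> (1 : R).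
Proof.
move=> /andP[y0 y1]; have y0' : 0 <= y by lra.
rewrite -[X in _ --> X]subr0; apply: cvgB; first exact: cvg_cst.
have yp : 0 < 2 * y by lra.
apply: (@squeeze_cvgr _ _ _ _ (cst 0) (fun n => (2 * y)^-1 ^+ n)).
- apply: nearW => n; have yn0 : 0 <= y ^+ n by exact: exprn_ge0.
  have yn1 : y ^+ n <= 1 by exact: exprn_ile1.
  rewrite /= exprn_ge0 ?subr_ge0//= exprVn -[leRHS]mul1r ler_pdivlMr ?exprn_gt0//.
  apply: (@le_trans _ _ ((1 - y ^+ n) ^+ (2 ^ n) * (1 + y ^+ n) ^+ (2 ^ n))).
    rewrite ler_wpM2l ?exprn_ge0 ?subr_ge0//.
    apply: le_trans (bernoulli_le (2 ^ n) _); last by lra.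
    by rewrite exprMn -natrX lerDr.
  rewrite -exprMn -subr_sqr expr1n exprn_ile1 ?subr_ge0 ?lerBlDr ?lerDl ?sqr_ge0//.
  by rewrite exprn_ile1.
- exact: cvg_cst.
- apply: cvg_expr; rewrite ger0_norm ?invr_ge0 ?(ltW yp)// invf_lt1//; lra.
Qed.

Lemma ae_off_finite (s : seq R) (P : R -> Prop) :
  (forall x, T x -> x \notin s -> P x) -> {ae mu, forall x, T x -> P x}.
Proof.
move=> sP; exists [set` s]; split.
- by apply: countable_measurable => [t|]; [exact: measurable_set1|]; apply: finite_set_countable; exact: finite_seq.
- by apply: countable_lebesgue_measure0; apply: finite_set_countable; exact: finite_seq.
- move=> x /= /not_implyP[Tx nP]; apply: contrapT => /negP xs.
  exact: nP (sP x Tx xs).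
Qed.

Lemma torusE x : T x = (0 <= x <= 2 * pi) :> Prop.
Proof. by rewrite /torus /= in_itv. Qed.

Lemma measurable_bump b n :
  @measurable_fun _ _ (measurableTypeR R) R T (bump b n).
Proof.
apply: measurable_funTS; apply: continuous_measurable_fun.
have cX (F : R -> R) m : continuous F -> continuous (fun x => F x ^+ m).
  move=> cF x; elim: m => [|m IH]; first by under eq_fun do rewrite expr0; exact: cvg_cst.
  rewrite /continuous_at exprS; under eq_fun do rewrite exprS.
  by apply: cvgM IH; exact: cF.
have cs : continuous (step b).
  rewrite (_ : step b = fun x => 2^-1 + (cos (x - b / 2) - cos (b / 2)) / 4); last first.
    by apply/funext => x; rewrite stepE.
  move=> x; apply: cvgD; first exact: cvg_cst.
  apply: cvgM; last exact: cvg_cst.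
  apply: cvgB; last exact: cvg_cst.
  apply: (@continuous_comp _ _ _ (fun x => x - b / 2) cos); last exact: continuous_cos.
  by apply: cvgB; [exact: cvg_id|exact: cvg_cst].
move=> x; apply: cvgB; first exact: cvg_cst.
apply: (cX (fun x => 1 - step b x ^+ n)) => y.
by apply: cvgB; [exact: cvg_cst|exact: cX].
Qed.

Lemma step01 b x : 0 <= step b x <= 1.
Proof.
rewrite stepE; have := cos_le1 (x - b / 2); have := cos_geN1 (x - b / 2).
have := cos_le1 (b / 2); have := cos_geN1 (b / 2).
by move=> *; apply/andP; split; lra.
Qed.

Lemma step_gt b x : 0 < x < 2 * pi -> 0 < b < 2 * pi -> x < b -> 2^-1 < step b x.
Proof.
move=> /andP[x0 x1] /andP[b0 b1] xb; rewrite /step ltrDl divr_gt0// mulr_gt0//.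
- by apply: sin_gt0_pi; apply/andP; split; lra.
- by apply: sin_gt0_pi; apply/andP; split; lra.
Qed.

Lemma step_lt b x : 0 < x < 2 * pi -> 0 < b < 2 * pi -> b < x -> step b x < 2^-1.
Proof.
move=> /andP[x0 x1] /andP[b0 b1] xb; rewrite /step gtrDl.
rewrite pmulr_llt0 ?invr_gt0// pmulr_rlt0; last first.
  by apply: sin_gt0_pi; apply/andP; split; lra.
rewrite -oppr_gt0 -sinN; apply: sin_gt0_pi; apply/andP; split; lra.
Qed.

Lemma bump_cvg (b x : R) : 0 < x < 2 * pi -> 0 < b < 2 * pi -> x != b ->
  bump b n x @[n --> \oo] --> ((x <= b)%R%:R : R).
Proof.
move=> x02 b02 xb; have /andP[s0 s1] := step01 b x.
have [xltb|bltx|xeqb] := ltgtP x b; last by rewrite xeqb eqxx in xb.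
- by apply: pow_step_gt; rewrite step_gt.
- by apply: pow_step_lt; rewrite step_lt// s0.
Qed.

(** A real integrable function against which all [bump b n] integrate to zero
    has vanishing integral over each interval [0, b], by dominated
    convergence; so it is zero by Lebesgue differentiation. *)
Lemma bump_complete (g : R -> R) : mu.-integrable T (EFin \o g) ->
  (forall b n, \int[mu]_(x in T) (bump b n x * g x) = 0) ->
  {ae mu, forall x, T x -> g x = 0}.
Proof.
move=> ig g0; have /integrableP[/measurable_EFinP mg _] := ig.
have Ib b : 0 < b < 2 * pi -> \int[mu]_(x in `[0, b]) (g \_ T) x = 0.
  move=> b02; have mI : @measurable_fun _ _ (measurableTypeR R) R T (\1_`[0, b] : R -> R).
    by apply: measurable_indic; exact: measurable_itv.
  have -> : \int[mu]_(x in `[0, b]) (g \_ T) x = \int[mu]_(x in T) (\1_`[0, b] x * g x).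
    rewrite Rintegral_mkcond [RHS]Rintegral_mkcond; apply: eq_Rintegral => x _.
    rewrite !patchE indicE; case: (x \in T); case: (x \in `[0, b]%classic) => //;
      by rewrite ?mul1r ?mul0r.
  have mbg n : @measurable_fun _ _ (measurableTypeR R) R T (fun x => bump b n x * g x).
    by apply: measurable_funM mg; exact: measurable_bump.
  have lim_bg : {ae mu, forall x, T x ->
      (bump b n x * g x)%:E @[n --> \oo] --> (\1_`[0, b] x * g x)%:E}.
    apply: (@ae_off_finite [:: 0; b; 2 * pi]) => x; rewrite torusE => /andP[x0 x2].
    rewrite !inE !negb_or => /and3P[x0' xb x2'].
    have x02 : 0 < x < 2 * pi by rewrite !lt_neqAle eq_sym x0' x0 x2' x2.
    apply: cvg_EFin; first exact: nearW.
    rewrite /comp; apply: cvgM; last exact: cvg_cst.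
    rewrite indicE (_ : (x \in _) = (x <= b)); first exact: bump_cvg.
    by rewrite mem_setE in_itv/= x0.
  have bg_le n x : `|bump b n x * g x| <= `|g x|.
    rewrite normrM ler_piMl//.
    have /andP[b0 b1] := pow_step_bounds n (step01 b x).
    by rewrite ger0_norm.
  have bg_dom : {ae mu, forall x n, T x -> (`|(bump b n x * g x)%:E| <= `|g x|%:E)%E}.
    by apply: filterE => x n Tx; rewrite lee_fin.
  have [_ _] := @dominated_convergence _ _ _ mu _ (@measurable_torus R)
    (fun n x => (bump b n x * g x)%:E) (fun x => (\1_`[0, b] x * g x)%:E)
    (fun x => `|g x|%:E)
    (fun n => iffRL (measurable_EFinP _ _) (mbg n))
    (iffRL (measurable_EFinP _ _) (measurable_funM mI mg))
    lim_bg (integrable_norm ig) bg_dom.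
  have -> : [sequence (\int[mu]_(x in T) (bump b n x * g x)%:E)%E]_n = cst 0%E.
    apply/funext => n /=; rewrite -[LHS]fineK; first by congr EFin; exact: g0.
    apply: (integrable_fin_num (@measurable_torus R)).
    apply: le_integrable ig => //; first exact/measurable_EFinP.
    by move=> x Tx /=; rewrite lee_fin.
  move=> /(cvg_lim (@ereal_hausdorff R)) H; rewrite /Rintegral -H.
  by rewrite lim_cst//; exact: ereal_hausdorff.
have ig' : mu.-integrable setT (EFin \o (g \_ T)).
  by move/(integrable_mkcond _ (@measurable_torus R)) : ig; rewrite restrict_EFin.
have igy y : mu.-integrable [set` Interval (BLeft 0) (BRight y)] (EFin \o (g \_ T)).
  by apply: integrableS ig' => //; exact: measurable_itv.
have inner_pt : {ae mu, forall x, T x -> 0 < x < 2 * pi}.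
  apply: (@ae_off_finite [:: 0; 2 * pi]) => x; rewrite torusE => /andP[x0 x2].
  by rewrite !inE !negb_or => /andP[x0' x2']; rewrite !lt_neqAle eq_sym x0' x0 x2' x2.
apply: filterS2 inner_pt (FTC1 igy (integrable_locally_restrict (@measurable_torus R) ig)).
move=> x + + Tx => /(_ Tx) /andP[x0 x2] /(_ x0)[_].
rewrite patchE mem_set// => <-.
rewrite derive1E (near_eq_derive (g := cst 0)) ?derive_cst//.
near=> y; rewrite Ib//; apply/andP; split; near: y.
- exact: lt_nbhsr.
- exact: lt_nbhsl.
Unshelve. all: by end_near. Qed.

(** The trigonometric system is complete: f annihilates every trigonometric
    polynomial, in particular every [bump b n]. *)
Theorem fourier_injective f : in_L2 f -> (forall k, fourier f k = 0) ->
  torus_ae_eq f (fun=> 0).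
Proof.
move=> Lf f0; have [if1 if2] : cintegrable f.
  have := in_L2M_cintegrable (in_Loo_L2 (in_Loo_cst 1)) Lf.
  by under [X in cintegrable X -> _]eq_fun do rewrite mul1r.
have I0 b n : cintegral (fun x => (bump b n x)%:C * f x) = 0.
  have [_ /(_ 0)/eqP] := annihilates_bump Lf b n f0.
  rewrite /fourier /inner mulf_eq0 => /orP[|/eqP <-].
    by rewrite fmorph_eq0 invr_eq0 gt_eqF// twopi_gt0.
  by congr cintegral; apply/funext => x; rewrite cexp0 conjc1 mulr1.
have := bump_complete if2; have := bump_complete if1.
move=> H1 H2; apply: filterS2 (H1 _) (H2 _).
- move=> x /[swap] + /[swap] Tx => /(_ Tx) + /(_ Tx).
  by move=> *; apply: complex_ext.
- move=> b n; have /(congr1 (@complex.Re R)) /= <- := I0 b n.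
  by apply: eq_Rintegral => x _; rewrite ReM /= mul0r subr0.
- move=> b n; have /(congr1 (@complex.Im R)) /= <- := I0 b n.
  by apply: eq_Rintegral => x _; rewrite ImM /= mul0r addr0.
Qed.

End TrigCompleteness.

(** * The space L^2_+ and its projection *)

Section HardySpace.
Variable R : realType.

Local Notation mu := (@lebesgue_measure R).
Local Notation normc := ComplexField.Normc.normc.
Local Notation T := (@torus R).

Implicit Types (f g h p q b v : torus_fun R) (c : R[i]) (k l : int).

Lemma le0_of_cvg0 (a : R) (d : nat -> R) : d n @[n --> \oo] --> (0 : R) ->
  (exists m, forall n, (m <= n)%N -> a <= d n) -> a <= 0.
Proof.
move=> d0 [m ad]; rewrite -(cvg_lim (@Rhausdorff R) d0).
apply: limr_ge; first by apply/cvg_ex; exists 0.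
by exists m => // n /= /ad.
Qed.

Lemma normc_le0 (z : R[i]) : normc z ^+ 2 <= 0 -> z = 0.
Proof.
by move=> z0; apply: ComplexField.Normc.eq0_normc; apply/eqP;
  rewrite -sqrf_eq0 eq_le z0 sqr_ge0.
Qed.

Lemma L2sq_cexp k : L2sq (cexp k : torus_fun R) = 1.
Proof. by apply: (@complexI R); rewrite -inner_self inner_cexp eqxx. Qed.

(** In the Riesz-Fischer theorem the limit has the prescribed coefficients,
    because each of them is continuous for the L^2 norm. *)
Lemma fourier_surjective (c : nat -> R[i]) (B : R) :
  (forall N, \sum_(n <- iota 0 N) normc (c n) ^+ 2 <= B) ->
  exists g, [/\ in_L2 g, forall n, fourier g (freq n) = c n &
    L2sq (fun x => g x - trig_sum c (iota 0 N) x) @[N --> \oo] --> (0 : R)].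
Proof.
move=> cB; have [g Lg cg] := riesz_fischer cB; exists g; split=> // n.
have LS N := in_L2_trig_sum c (iota 0 N).
apply/eqP; rewrite -subr_eq0; apply/eqP/normc_le0.
apply: le0_of_cvg0 cg _; exists n.+1 => N nN.
have := inner_cauchy_schwarz (in_L2B Lg (LS N)) (in_L2_cexp R (freq n)).
rewrite L2sq_cexp mulr1 innerBl//; last exact: in_L2_cexp.
by rewrite -!/(fourier _ _) fourier_trig_sum ?iota_uniq// mem_iota add0n nN.
Qed.

(** By Bessel's inequality the Fourier series has a limit in L^2, which has the
    same coefficients as f and so coincides with it. *)
Lemma fourier_series_cvg f : in_L2 f ->
  L2sq (fun x => f x - trig_sum (fun n => fourier f (freq n)) (iota 0 N) x)
    @[N --> \oo] --> (0 : R).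
Proof.
move=> Lf; have [N|g [Lg fg cg]] := @fourier_surjective (fun n => fourier f (freq n)) (L2sq f).
  by apply: bessel => //; exact: iota_uniq.
have fgE : torus_ae_eq f g.
  have := @fourier_injective _ _ (in_L2B Lf Lg); move=> H.
  apply: filterS (H _) => [x + Tx|k]; first by move=> /(_ Tx)/eqP; rewrite subr_eq0 => /eqP.
  rewrite /fourier innerBl//; last exact: in_L2_cexp.
  by rewrite -!/(fourier _ _) -(freq_indexK k) fg subrr.
apply: cvg_trans cg; apply: near_eq_cvg; apply: nearW => N.
have LS := in_L2_trig_sum (fun n => fourier f (freq n)) (iota 0 N).
apply: L2sq_ae_eq; [exact: in_L2B|exact: in_L2B|].
by apply: filterS fgE => x + Tx => ->.
Qed.

(** The part of Parseval's identity on which the rest is built: orthogonality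
    can be checked frequency by frequency. *)
Lemma inner_eq0 f g : in_L2 f -> in_L2 g ->
  (forall k, fourier f k = 0 \/ inner (cexp k) g = 0) -> inner f g = 0.
Proof.
move=> Lf Lg fg0; apply/normc_le0.
have S0 : (L2sq (fun x => f x - trig_sum (fun n => fourier f (freq n)) (iota 0 N) x) * L2sq g)
    @[N --> \oo] --> (0 : R).
  by rewrite -(mul0r (L2sq g)); apply: cvgM; [exact: fourier_series_cvg|exact: cvg_cst].
apply: le0_of_cvg0 S0 _; exists 0%N => N _.
have LS := in_L2_trig_sum (fun n => fourier f (freq n)) (iota 0 N).
have := inner_cauchy_schwarz (in_L2B Lf LS) Lg; rewrite innerBl// inner_trig_sum//.
rewrite (big1 _ _ (fun n => fourier f (freq n) * _)) ?subr0// => n _.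
by case: (fg0 (freq n)) => ->; rewrite ?mul0r ?mulr0.
Qed.

Lemma in_L2plus_L2 f : in_L2plus f -> in_L2 f. Proof. by case. Qed.
#[local] Hint Resolve in_L2plus_L2 in_L2_cexp : core.

Lemma in_L2plusD f g : in_L2plus f -> in_L2plus g -> in_L2plus (fun x => f x + g x).
Proof.
move=> [Lf f0] [Lg g0]; split; first exact: in_L2D.
move=> k k0; rewrite /fourier innerDl//.
by rewrite -!/(fourier _ _) f0// g0// addr0.
Qed.

Lemma in_L2plusZ c f : in_L2plus f -> in_L2plus (fun x => c * f x).
Proof.
move=> [Lf f0]; split; first exact: in_L2Z.
by move=> k k0; rewrite /fourier innerZl// -/(fourier _ _) f0// mulr0.
Qed.

Lemma in_L2plusB f g : in_L2plus f -> in_L2plus g -> in_L2plus (fun x => f x - g x).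
Proof.
move=> Pf Pg; have := in_L2plusD Pf (in_L2plusZ (-1) Pg).
by under [X in in_L2plus X -> _]eq_fun do rewrite mulN1r.
Qed.

Lemma fourier_cexpM f k l :
  fourier (fun x => cexp l x * f x) k = fourier f (k - l).
Proof.
rewrite /fourier (inner_mull (cexp l)).
have -> // : (fun x => ((cexp l x)^*)%C * cexp k x) = cexp (k - l) :> torus_fun R.
by apply/funext => x; rewrite cexp_conj -cexpD addrC.
Qed.

Lemma in_L2plus_shift l f : 0 <= l -> in_L2plus f ->
  in_L2plus (fun x => cexp l x * f x).
Proof.
move=> l0 [Lf f0]; split; first by apply: in_LooM_L2 => //; exact: in_Loo_cexp.
by move=> k k0; rewrite fourier_cexpM f0//; lia.
Qed.

(** Says that the coefficient of index k < 0 of the product f g vanishes. The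
    product is only integrable; f is replaced by its Fourier series, against
    which g is tested one frequency at a time. *)
Lemma inner_conj_L2plus f g k : in_L2plus f -> in_L2plus g -> k < 0 ->
  inner f (fun x => ((g x)^*)%C * cexp k x) = 0.
Proof.
move=> [Lf f0] [Lg g0] k0; apply: inner_eq0 => //.
  by apply: in_L2M_Loo; [exact: in_L2_conj|exact: in_Loo_cexp].
move=> l; have [l0|l0] := ltP l 0; [by left; exact: f0|right].
rewrite -(inner_mull g).
have -> : (fun x => g x * cexp l x) = (fun x => cexp l x * g x).
  by apply/funext => x; exact: mulrC.
by rewrite -/(fourier _ _) fourier_cexpM g0//; lia.
Qed.

Lemma in_L2plusM b f : in_Loo b -> in_L2plus b -> in_L2plus f ->
  in_L2plus (fun x => b x * f x).
Proof.
move=> Lb Pb Pf; split; first by apply: in_LooM_L2 => //; exact: in_L2plus_L2.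
move=> k k0; rewrite /fourier.
have -> : (fun x => b x * f x) = (fun x => f x * b x).
  by apply/funext => x; exact: mulrC.
by rewrite (inner_mull f); exact: inner_conj_L2plus.
Qed.

Lemma in_L2plus_cexp k : 0 <= k -> in_L2plus (cexp k : torus_fun R).
Proof.
move=> k0; split => // l l0; rewrite /fourier inner_cexp.
by case: eqP => // kl; lia.
Qed.

(** Formally this is the pairing of b with the product h g. As h g need not be
    square-integrable, g is replaced by its Fourier series: each h e^{ikx} with
    k >= 0 does belong to L^2_+. *)
Lemma inner_orthogonal b h g : in_Loo b ->
  (forall f, in_L2plus f -> inner b f = 0) ->
  in_L2plus h -> in_L2plus g ->
  inner (fun x => b x * ((h x)^*)%C) g = 0.
Proof.
move=> Lb b0 Ph Pg; have Lh := in_L2plus_L2 Ph; have Lg := in_L2plus_L2 Pg.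
have Lbh : in_L2 (fun x => b x * ((h x)^*)%C).
  by apply: in_LooM_L2 => //; exact: in_L2_conj.
rewrite innerC//; apply/eqP; rewrite conjc_eq0; apply/eqP.
apply: inner_eq0 => // k; have [k0|k0] := ltP k 0; first by left; exact: Pg.2.
right; rewrite innerC//; apply/eqP; rewrite conjc_eq0; apply/eqP.
have -> : (fun x => b x * ((h x)^*)%C) = (fun x => ((h x)^*)%C * b x).
  by apply/funext => x; exact: mulrC.
rewrite (inner_mull (fun x => ((h x)^*)%C)).
have -> : (fun x => ((h x)^*^*)%C * cexp k x) = (fun x => cexp k x * h x).
  by apply/funext => x; rewrite conjcK mulrC.
by apply: b0; exact: in_L2plus_shift.
Qed.

Lemma L2plus_ae0 f : in_L2plus f -> inner f f = 0 -> torus_ae_eq f (fun=> 0).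
Proof.
move=> [Lf _] f0; apply: L2sq_eq0 => //.
by apply: (@complexI R); rewrite -inner_self f0.
Qed.

Lemma is_orthoproj_L2plus f g : is_orthoproj f g -> in_L2plus g.
Proof. by case. Qed.

(** The projection keeps the coefficients of nonnegative index. *)
Lemma is_orthoproj_exists f : in_L2 f -> exists g, is_orthoproj f g.
Proof.
move=> Lf; pose c n := if 0 <= freq n then fourier f (freq n) else 0.
have [N|g [Lg gc _]] := @fourier_surjective c (L2sq f).
  apply: le_trans (bessel Lf (iota_uniq 0 N)); apply: ler_sum => n _.
  by rewrite /c; case: ifP => // _; rewrite ComplexField.Normc.normc0 expr0n sqr_ge0.
have gk k : fourier g k = if 0 <= k then fourier f k else 0.
  by rewrite -[k]freq_indexK gc.
exists g; split; first by split=> // k k0; rewrite gk leNgt k0.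
move=> h [Lh h0]; have Lfg := in_L2B Lf Lg.
rewrite innerC//; apply/eqP; rewrite conjc_eq0; apply/eqP.
apply: inner_eq0 => // k; have [k0|k0] := ltP k 0; first by left; exact: h0.
right; rewrite innerC//; apply/eqP; rewrite conjc_eq0; apply/eqP.
by rewrite innerBl// -!/(fourier _ _) gk k0 subrr.
Qed.

Lemma PiP f : in_L2 f -> is_orthoproj f (Pi f).
Proof.
move=> Lf; rewrite /Pi; case: xgetP => [g _ //|H].
by have [g /H] := is_orthoproj_exists Lf.
Qed.

Lemma in_L2plus_Pi f : in_L2 f -> in_L2plus (Pi f).
Proof. by move=> /PiP/is_orthoproj_L2plus. Qed.

Lemma inner_orthoproj f g h : in_L2 f -> is_orthoproj f g -> in_L2plus h ->
  inner g h = inner f h.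
Proof.
move=> Lf [Pg fg] Ph; apply/eqP; rewrite eq_sym -subr_eq0 -innerBl ?fg//; exact: in_L2plus_L2.
Qed.

Lemma is_orthoprojP f g : in_L2 f -> in_L2plus g ->
  (forall h, in_L2plus h -> inner g h = inner f h) -> is_orthoproj f g.
Proof.
move=> Lf Pg gf; split=> // h Ph; rewrite innerBl//; [|exact: in_L2plus_L2..].
by rewrite gf// subrr.
Qed.

Lemma is_orthoproj_unique f f' g g' : in_L2 f -> in_L2 f' ->
  is_orthoproj f g -> is_orthoproj f' g' ->
  (forall h, in_L2plus h -> inner f h = inner f' h) -> torus_ae_eq g g'.
Proof.
move=> Lf Lf' fg fg' ff'.
have Pg := is_orthoproj_L2plus fg; have Pg' := is_orthoproj_L2plus fg'.
have Pd := in_L2plusB Pg Pg'.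
have : torus_ae_eq (fun x => g x - g' x) (fun=> 0).
  apply: L2plus_ae0 => //; rewrite innerBl//; [|exact: in_L2plus_L2..].
  by rewrite (inner_orthoproj Lf fg)// (inner_orthoproj Lf' fg')// ff'// subrr.
by apply: filterS => x + Tx => /(_ Tx)/eqP; rewrite subr_eq0 => /eqP.
Qed.

Lemma is_orthoproj_id f : in_L2plus f -> is_orthoproj f f.
Proof. by move=> Pf; apply: is_orthoprojP => //; exact: in_L2plus_L2. Qed.

Lemma is_orthoprojD f f' g g' : in_L2 f -> in_L2 f' ->
  is_orthoproj f g -> is_orthoproj f' g' ->
  is_orthoproj (fun x => f x + f' x) (fun x => g x + g' x).
Proof.
move=> Lf Lf' fg fg'.
have Pg := is_orthoproj_L2plus fg; have Pg' := is_orthoproj_L2plus fg'.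
apply: is_orthoprojP; [exact: in_L2D|exact: in_L2plusD|move=> h Ph].
have Lh := in_L2plus_L2 Ph.
rewrite !innerDl//; [|exact: in_L2plus_L2..].
by rewrite (inner_orthoproj Lf fg)// (inner_orthoproj Lf' fg').
Qed.

Lemma is_orthoprojZ c f g : in_L2 f -> is_orthoproj f g ->
  is_orthoproj (fun x => c * f x) (fun x => c * g x).
Proof.
move=> Lf fg; have Pg := is_orthoproj_L2plus fg.
apply: is_orthoprojP; [exact: in_L2Z|exact: in_L2plusZ|move=> h Ph].
have Lh := in_L2plus_L2 Ph.
rewrite !innerZl//; last exact: in_L2plus_L2.
by rewrite (inner_orthoproj Lf fg).
Qed.

Lemma is_orthoprojB f f' g g' : in_L2 f -> in_L2 f' ->
  is_orthoproj f g -> is_orthoproj f' g' ->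
  is_orthoproj (fun x => f x - f' x) (fun x => g x - g' x).
Proof.
move=> Lf Lf' fg fg'.
have := is_orthoprojD Lf (in_L2Z (-1) Lf') fg (is_orthoprojZ (-1) Lf' fg').
under [X in is_orthoproj X]eq_fun do rewrite mulN1r.
by under [X in is_orthoproj _ X]eq_fun do rewrite mulN1r.
Qed.

(** The defining property of a projection only sees the function through its
    pairings with L^2_+. *)
Lemma is_orthoproj_eq f f' g : in_L2 f -> in_L2 f' ->
  (forall h, in_L2plus h -> inner f h = inner f' h) ->
  is_orthoproj f g -> is_orthoproj f' g.
Proof.
move=> Lf Lf' ff' fg; apply: is_orthoprojP => //; first exact: is_orthoproj_L2plus fg.
by move=> h Ph; rewrite (inner_orthoproj Lf fg)// ff'.
Qed.

Lemma L2sq_orthoproj f g : in_L2 f -> is_orthoproj f g -> L2sq g <= L2sq f.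
Proof.
move=> Lf fg; have Pg := is_orthoproj_L2plus fg; have Lg := in_L2plus_L2 Pg.
have := L2sq_ge0 (fun x => f x - g x); rewrite L2sqB//.
by rewrite -(inner_orthoproj Lf fg Pg) inner_self /=; lra.
Qed.

Lemma L2sq_le f g : in_L2 f -> in_L2 g ->
  {ae mu, forall x, T x -> normc (f x) <= normc (g x)} -> L2sq f <= L2sq g.
Proof.
move=> Lf Lg fg; rewrite -(@ler_pM2l _ (2 * pi)) ?twopi_gt0// -lee_fin.
rewrite -!integral_normc_sq//.
apply: ae_ge0_le_integral => //; do ?by move=> x _; rewrite lee_fin sqr_ge0.
- by apply/measurable_EFinP; apply: torus_measurable_normc; case: Lf.
- by apply/measurable_EFinP; apply: torus_measurable_normc; case: Lg.
- apply: filterS fg => x + Tx => /(_ Tx) fg.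
  by rewrite lee_fin ler_sqr ?nnegrE ?normc_ge0.
Qed.

End HardySpace.

(** * The Sobolev embedding *)

Section Sobolev.
Variable R : realType.

Local Notation mu := (@lebesgue_measure R).
Local Notation normc := ComplexField.Normc.normc.
Local Notation T := (@torus R).

Implicit Types (f v : torus_fun R) (s : R).

Lemma sum_iota_le (F : nat -> R) m n : (forall i, 0 <= F i) -> (m <= n)%N ->
  \sum_(i <- iota 0 m) F i <= \sum_(i <- iota 0 n) F i.
Proof.
by move=> F0 mn; rewrite -(subnKC mn) iotaD big_cat/= lerDl sumr_ge0.
Qed.

Lemma freq_sq_ge (n : nat) : n.+1%:R ^+ 2 / 8 <= 1 + (freq n)%:~R ^+ 2 :> R.
Proof.
rewrite /freq -[X in X.+1%:R](odd_double_half n); case: (odd n).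
- rewrite NegzE mulrNz sqrrN -[(Posz _)%:~R]/(_%:R) add1n -muln2.
  rewrite -addn2 natrD natrM -[n./2.+1]addn1 natrD; set m : R := _%:R.
  by have m0 : 0 <= m by [exact: ler0n]; nra.
- rewrite -[(Posz _)%:~R]/(_%:R) add0n -muln2 -addn1 natrD natrM.
  by set m : R := _%:R; have m0 : 0 <= m by [exact: ler0n]; nra.
Qed.

(** The block 2^m <= n + 1 < 2^(m+1) has 2^m terms, each at most 8^s 4^(- s m)
    by [freq_sq_ge]: the blocks are dominated by a geometric series of ratio
    2 / 4^s, which is less than 1. *)
Lemma weight_inv_sum s : 2^-1 < s -> exists2 Z : R, 0 <= Z &
  forall N, \sum_(n <- iota 0 N) ((1 + (freq n)%:~R ^+ 2) `^ s)^-1 <= Z.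
Proof.
move=> s12; have s0 : 0 <= s by apply: le_trans (ltW s12); rewrite invr_ge0.
pose F n : R := ((1 + (freq n)%:~R ^+ 2) `^ s)^-1.
have F0 n : 0 <= F n by rewrite invr_ge0 powR_ge0.
pose q : R := 2 / 4 `^ s.
have s4 : 2 < 4 `^ s :> R.
  have -> : 2 = 4 `^ 2^-1 :> R.
    by rewrite powR12_sqrt// (_ : 4 = 2 ^+ 2) ?sqrtr_sqr ?ger0_norm// -natrX.
  rewrite /powR (gt_eqF (_ : 0 < 4))// ltr_expR ltr_pM2r//.
  by rewrite ln_gt0// ltr1n.
have s4p : 0 < 4 `^ s :> R by exact: lt_trans s4.
have q1 : 0 < 1 - q by rewrite subr_gt0 /q ltr_pdivrMr// mul1r.
have q0 : 0 <= q by rewrite /q divr_ge0// ltW.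
pose A := (8 `^ s) / (1 - q).
have A0 : 0 <= A by rewrite divr_ge0 ?powR_ge0// ltW.
exists A => // N.
have FB m n : (2 ^ m <= n.+1)%N -> F n <= 8 `^ s / (4 `^ s) ^+ m.
  move=> mn; rewrite -[leRHS]invrK lef_pV2 ?posrE ?invr_gt0 ?divr_gt0 ?powR_gt0 ?exprn_gt0//; last first.
    by rewrite ltr_pwDl ?sqr_ge0.
  rewrite invf_div ler_pdivrMr ?powR_gt0// -powR_mulrn ?powR_ge0// -powRrM mulrC powRrM.
  rewrite -powRM ?addr_ge0 ?sqr_ge0//.
  apply: ge0_ler_powR => //; rewrite ?nnegrE ?powR_ge0 ?mulr_ge0 ?addr_ge0 ?sqr_ge0//.
  rewrite powR_mulrn//; have := freq_sq_ge n.
  rewrite ler_pdivrMr//; apply: le_trans.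
  by rewrite -!natrX ler_nat (_ : 4 = 2 ^ 2)%N// -expnM mulnC expnM leq_sqr.
have dyadic M : \sum_(n <- iota 0 (2 ^ M).-1) F n <= A * (1 - q ^+ M).
  elim: M => [|M IH]; first by rewrite big_nil expr0 subrr mulr0.
  have -> : (2 ^ M.+1).-1 = ((2 ^ M).-1 + 2 ^ M)%N.
    by rewrite expnS mul2n -addnn; have := expn_gt0 2 M; case: (2 ^ M)%N.
  rewrite iotaD big_cat/= add0n.
  apply: (@le_trans _ _ (A * (1 - q ^+ M) + 8 `^ s * q ^+ M)); last first.
    rewrite /A exprS le_eqVlt; apply/orP; left; apply/eqP; field.
    by rewrite gt_eqF.
  apply: lerD => //.
  apply: (@le_trans _ _ (\sum_(n <- iota (2 ^ M).-1 (2 ^ M)) 8 `^ s / (4 `^ s) ^+ M)).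
    rewrite !(big_seq _ _ (iota _ _)); apply: ler_sum => n; rewrite mem_iota => /andP[nM _].
    by apply: FB; move: nM; have := expn_gt0 2 M; case: (2 ^ M)%N.
  rewrite big_const_seq count_predT size_iota iter_addr_0 /q expr_div_n -natrX.
  rewrite le_eqVlt; apply/orP; left; apply/eqP.
  by rewrite -[LHS]mulr_natr -mulrA; congr (_ * _); rewrite mulrC.
apply: (@le_trans _ _ (\sum_(n <- iota 0 (2 ^ N).-1) F n)).
  by apply: sum_iota_le => //; have := ltn_expl N (isT : 1 < 2)%N; case: (2 ^ N)%N.
by apply: le_trans (dyadic N) _; rewrite ler_piMr// gerBl exprn_ge0.
Qed.

Lemma Hsnorm_sum_le s v (e : R) N : 0 <= e -> (Hsnorm s v <= e%:E)%E ->
  \sum_(n <- iota 0 N) (1 + (freq n)%:~R ^+ 2) `^ s * normc (fourier v (freq n)) ^+ 2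
    <= e ^+ 2.
Proof.
move=> e0; rewrite /Hsnorm; set X := esum _ _ => XE.
have X0 : (0 <= X)%E.
  by apply: esum_ge0 => k _; rewrite lee_fin mulr_ge0 ?powR_ge0 ?sqr_ge0.
have : (X <= (e ^+ 2)%:E)%E.
  move: XE; rewrite poweR12_sqrt//; clearbody X; case: X X0 => [r|//|//] r0 /=.
  rewrite !lee_fin => re; rewrite -(sqr_sqrtr (_ : 0 <= r))//.
  by rewrite ler_sqr ?nnegrE ?sqrtr_ge0.
rewrite -lee_fin; apply: le_trans.
rewrite -sumEFin.
apply: esum_ge; exists [set` [seq freq n | n <- iota 0 N]].
  by split => //; exact: finite_seq.
rewrite -fsbig_seq; last by rewrite (map_inj_uniq (@freq_inj)) iota_uniq.
by rewrite big_map.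
Qed.

Lemma measurable_normc f : torus_measurable f ->
  @measurable_fun _ _ (measurableTypeR R) R T (fun x => normc (f x)).
Proof.
move=> /torus_measurable_normc mf.
rewrite (_ : (fun x => _) = (fun x => Num.sqrt (normc (f x) ^+ 2))); last first.
  by apply/funext => x; rewrite sqrtr_sqr ger0_norm ?normc_ge0.
apply: measurableT_comp mf; apply: continuous_measurable_fun; exact: sqrt_continuous.
Qed.

(** Each partial sum S_N f is bounded by M everywhere, so that the excess of |f|
    over M is dominated by |f - S_N f|, which tends to 0 in L^2. *)
Lemma ae_bounded_of_fourier_sums f (M : R) : in_L2 f -> 0 <= M ->
  (forall N, \sum_(n <- iota 0 N) normc (fourier f (freq n)) <= M) ->
  {ae mu, forall x, T x -> normc (f x) <= M}.
Proof.
move=> Lf M0 SM; pose E x : R[i] := (Num.max 0 (normc (f x) - M))%:C.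
have mE : torus_measurable E.
  apply/torus_measurableE; split => /=; last exact: measurable_cst.
  apply: measurable_maxr; first exact: measurable_cst.
  apply: measurable_funB; last exact: measurable_cst.
  by apply: measurable_normc; case: Lf.
have nE x : normc (E x) = Num.max 0 (normc (f x) - M).
  by rewrite normc_real ger0_norm// le_max lexx.
have LE : in_L2 E.
  have /in_L2P[_ If] := Lf.
  apply: in_L2_le If _ => // x; rewrite nE ler_sqr ?nnegrE ?normc_ge0// ?le_max ?lexx//.
  by rewrite ge_max normc_ge0/= gerBl.
have E0 : L2sq E <= 0.
  apply: le0_of_cvg0 (fourier_series_cvg Lf) _; exists 0%N => N _.
  apply: L2sq_le => //; first by apply: in_L2B => //; exact: in_L2_trig_sum.
  apply: filterE => x _; rewrite nE ge_max normc_ge0/= lerBlDr.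
  set S := trig_sum _ _ x.
  have -> : f x = (f x - S) + S by rewrite subrK.
  rewrite (le_trans (le_normcD _ _))// subrK lerD2l.
  apply: le_trans (SM N); rewrite /S /trig_sum.
  elim: (iota 0 N) => [|n r IH]; first by rewrite !big_nil ComplexField.Normc.normc0.
  rewrite !big_cons (le_trans (le_normcD _ _))// lerD//.
  by rewrite ComplexField.Normc.normcM normc_cexp mulr1.
have := L2sq_eq0 LE (le_anti (introT andP (conj E0 (L2sq_ge0 E)))).
apply: filterS => x + Tx => /(_ Tx) Ex0.
have := nE x; rewrite Ex0 ComplexField.Normc.normc0 => fM.
by rewrite -subr_le0 fM le_max lexx orbT.
Qed.

(** The bound comes from 2|a| <= e w^-1 + e^-1 w |a|^2 for each coefficient a of
    weight w: summed over the frequencies, the two terms contribute at most e Z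
    and e. *)
Lemma sobolev s : 2^-1 < s -> exists2 C : R, 0 < C &
  forall v (e : R), in_L2 v -> 0 < e -> (Hsnorm s v <= e%:E)%E ->
    {ae mu, forall x, T x -> normc (v x) <= C * e}.
Proof.
move=> s12; have [Z Z0 ZP] := weight_inv_sum s12.
exists ((Z + 1) / 2); first by rewrite divr_gt0// ltr_wpDl.
move=> v e Lv e0 He; apply: ae_bounded_of_fourier_sums => //.
  by rewrite mulr_ge0 ?(ltW e0)// divr_ge0// addr_ge0.
move=> N; have HN := Hsnorm_sum_le N (ltW e0) He.
apply: (@le_trans _ _ (\sum_(n <- iota 0 N)
   (e / 2 * ((1 + (freq n)%:~R ^+ 2) `^ s)^-1 +
    (2 * e)^-1 * ((1 + (freq n)%:~R ^+ 2) `^ s * normc (fourier v (freq n)) ^+ 2)))).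
  apply: ler_sum => n _; set w := _ `^ s; set a := normc _.
  have w0 : 0 < w by apply: powR_gt0; rewrite ltr_pwDl ?sqr_ge0.
  rewrite -subr_ge0 (_ : _ - a = (2 * e * w)^-1 * (e - w * a) ^+ 2).
    by rewrite mulr_ge0 ?sqr_ge0// invr_ge0 !mulr_ge0// ltW.
  by field; rewrite !gt_eqF.
rewrite big_split/= -!mulr_sumr.
apply: (@le_trans _ _ (e / 2 * Z + (2 * e)^-1 * e ^+ 2)).
  by apply: lerD; rewrite ler_wpM2l// ?divr_ge0 ?invr_ge0 ?mulr_ge0// ltW.
rewrite le_eqVlt; apply/orP; left; apply/eqP; field.
by rewrite gt_eqF.
Qed.

Lemma in_Hsplus_Loo s v : 2^-1 < s -> in_Hsplus s v -> in_Loo v.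
Proof.
move=> s12 [[Lv _] Hv]; have [C C0 CP] := sobolev s12.
split; first by case: Lv.
have H0 : (0 <= Hsnorm s v)%E by exact: poweR_ge0.
exists (C * (fine (Hsnorm s v) + 1)); apply: CP => //.
  by rewrite ltr_wpDl// fine_ge0.
rewrite -{1}(@fineK _ (Hsnorm s v)) ?ge0_fin_numE//.
by rewrite lee_fin lerDl.
Qed.

End Sobolev.

(** * The Lax pair *)

Section LaxPair.
Variable R : realType.

Local Notation mu := (@lebesgue_measure R).
Local Notation normc := ComplexField.Normc.normc.
Local Notation T := (@torus R).

Implicit Types (f g h p q b u v w : torus_fun R) (c : R[i]) (k l : int) (s : R).

Lemma opnorm_le (A : torus_fun R -> torus_fun R) (M : \bar R) :
  (forall h, in_L2plus h -> (L2norm h <= 1)%E -> (L2norm (A h) <= M)%E) ->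
  (opnorm A <= M)%E.
Proof. by move=> AM; apply: ub_ereal_sup => _ [h [Ph h1] <-]; exact: AM. Qed.

Lemma in_L2plus0 : in_L2plus (fun=> 0 : R[i]).
Proof. by split; [exact: in_L2_0 | move=> k _; exact: inner0l]. Qed.

Lemma opnorm_ge0 (A : torus_fun R -> torus_fun R) : (0 <= opnorm A)%E.
Proof.
apply: (@le_trans _ _ (L2norm (A (fun=> 0)))); first exact: poweR_ge0.
apply: ereal_sup_ubound; exists (fun=> 0) => //; split; first exact: in_L2plus0.
rewrite (@L2norm_le _ _ 1)//; last exact: in_L2_0.
rewrite (_ : L2sq _ = 0) ?expr1n//.
by apply: (@complexI R); rewrite -inner_self inner0l.
Qed.

Lemma L2norm_mul_orthoproj b h g (M : R) : in_Loo b -> in_L2plus h -> 0 <= M ->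
  {ae mu, forall x, T x -> normc (b x) <= M} -> (L2norm h <= 1)%E ->
  is_orthoproj (fun x => b x * h x) g -> (L2norm g <= M%:E)%E.
Proof.
move=> Lb Ph M0 bM h1 fg; have Lh := in_L2plus_L2 Ph.
have Lbh := in_LooM_L2 Lb Lh.
have Lg := in_L2plus_L2 (is_orthoproj_L2plus fg).
rewrite L2norm_le//; apply: le_trans (L2sq_orthoproj Lbh fg) _.
apply: (@le_trans _ _ (L2sq (fun x => M%:C * h x))).
  apply: L2sq_le => //; first exact: in_L2Z.
  apply: filterS bM => x + Tx => /(_ Tx) bM.
  by rewrite !ComplexField.Normc.normcM normc_real ger0_norm// ler_wpM2r ?normc_ge0.
rewrite L2sqZ// normc_real real_normK ?num_real// ler_piMr ?sqr_ge0//.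
by rewrite -[leRHS](expr1n _ 2) -L2norm_le.
Qed.

Lemma inner_mul_orthoproj b f g h : in_L2 f -> is_orthoproj f g ->
  in_L2plus (fun x => ((b x)^*)%C * h x) ->
  inner (fun x => b x * g x) h = inner (fun x => b x * f x) h.
Proof. by move=> Lf fg bh; rewrite !(inner_mull b); exact: inner_orthoproj. Qed.

(** The composed projections in the shifted Hankel operator collapse into one,
    because multiplication by e^{ix} preserves L^2_+. *)
Lemma shifted_HankelP u h : in_Loo u -> in_L2plus h ->
  is_orthoproj (fun x => cexp (- 1) x * (u x * ((h x)^*)%C)) (shifted_Hankel u h).
Proof.
move=> Lu Ph; have Lq : in_L2 (fun x => u x * ((h x)^*)%C).
  by apply: in_LooM_L2 => //; apply: in_L2_conj; exact: in_L2plus_L2.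
have PG := in_L2plus_Pi Lq; have LG := in_L2plus_L2 PG.
have Le f : in_L2 f -> in_L2 (fun x => cexp (- 1) x * f x).
  by apply: in_LooM_L2; exact: in_Loo_cexp.
apply: is_orthoproj_eq (PiP (Le _ LG)); [exact: Le|exact: Le|].
move=> g Pg; apply: inner_mul_orthoproj => //; first exact: PiP.
under eq_fun do rewrite cexp_conj opprK.
exact: in_L2plus_shift.
Qed.

Section Symbol.
Variable u : torus_fun R.
Hypotheses (Bu : in_Loo u) (Pu : in_L2plus u).

Local Notation c := (J u).
Local Notation K := (shifted_Hankel u).

(** The operator B_u is the Toeplitz operator of this single symbol, which is
    bounded and takes purely imaginary values; boundedness and
    anti-self-adjointness follow. *)
Definition lax_symbol x : R[i] := - 'i%C * (lax_symbol1 u x + lax_symbol2 u x).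

Lemma in_Loo_lax_symbol1 : in_Loo (lax_symbol1 u).
Proof. exact: in_LooZ. Qed.

Lemma in_Loo_lax_symbol2 : in_Loo (lax_symbol2 u).
Proof. by apply: in_LooZ; exact: in_Loo_conj. Qed.

Lemma in_Loo_lax_symbol : in_Loo lax_symbol.
Proof.
by apply: in_LooZ; apply: in_LooD; [exact: in_Loo_lax_symbol1|exact: in_Loo_lax_symbol2].
Qed.

Lemma conj_i : ('i%C^*)%C = - 'i%C :> R[i].
Proof. by apply: complex_ext => /=; rewrite ?oppr0. Qed.

Lemma conj_lax_symbol x : ((lax_symbol x)^*)%C = - lax_symbol x.
Proof.
rewrite /lax_symbol /lax_symbol1 /lax_symbol2; move: (J u) (u x) => a z.
by rewrite conjcM conjcD !conjcM conjcN !conjcK conj_i; ring.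
Qed.

Lemma lax_BP h : in_L2plus h -> is_orthoproj (fun x => lax_symbol x * h x) (lax_B u h).
Proof.
move=> Ph; have Lh := in_L2plus_L2 Ph.
have L1 := in_LooM_L2 in_Loo_lax_symbol1 Lh.
have L2 := in_LooM_L2 in_Loo_lax_symbol2 Lh.
have := is_orthoprojZ (- 'i%C) (in_L2D L1 L2) (is_orthoprojD L1 L2 (PiP L1) (PiP L2)).
apply: is_orthoproj_eq => [||g Pg].
- by apply: in_L2Z; exact: in_L2D.
- by apply: in_LooM_L2 => //; exact: in_Loo_lax_symbol.
- have -> // : (fun x => lax_symbol x * h x) =
    (fun x => - 'i%C * (lax_symbol1 u x * h x + lax_symbol2 u x * h x)).
  by apply/funext => x; rewrite /lax_symbol -mulrDl mulrA.
Qed.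

Lemma bounded_linear_lax_B : bounded_linear_L2plus (lax_B u).
Proof.
have Bb := in_Loo_lax_symbol.
have Lb h : in_L2plus h -> in_L2 (fun x => lax_symbol x * h x).
  by move=> /in_L2plus_L2; exact: in_LooM_L2.
split.
- by move=> h /lax_BP/is_orthoproj_L2plus.
- move=> h1 h2 P1 P2 h12.
  apply: (is_orthoproj_unique (Lb _ P1) (Lb _ P2) (lax_BP P1) (lax_BP P2)) => g Pg.
  have Lg := in_L2plus_L2 Pg.
  apply: (inner_ae_eq (Lb _ P1) (Lb _ P2) Lg Lg _ (torus_ae_eq_refl g)).
  exact: (torus_ae_eq_lift (fun x z => lax_symbol x * z) h12).
- move=> a h1 h2 P1 P2.
  have P12 := in_L2plusD (in_L2plusZ a P1) P2.
  have L12 := in_L2D (in_L2Z a (Lb _ P1)) (Lb _ P2).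
  apply: (is_orthoproj_unique (Lb _ P12) L12 (lax_BP P12)).
    exact: (is_orthoprojD (in_L2Z a (Lb _ P1)) (Lb _ P2)
      (is_orthoprojZ a (Lb _ P1) (lax_BP P1)) (lax_BP P2)).
  move=> g Pg; apply: eq_innerl => x.
  by rewrite mulrDr mulrCA.
- have [_ [M bM]] := Bb.
  apply: (@le_lt_trans _ _ `|M|%:E); last exact: ltry.
  apply: opnorm_le => h Ph h1.
  apply: (L2norm_mul_orthoproj Bb Ph _ _ h1 (lax_BP Ph)) => //.
  by apply: filterS bM => x + Tx => /(_ Tx) /le_trans; apply; exact: ler_norm.
Qed.

Lemma anti_selfadjoint_lax_B : anti_selfadjoint (lax_B u).
Proof.
move=> h1 h2 P1 P2; have L1 := in_L2plus_L2 P1; have L2 := in_L2plus_L2 P2.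
have Bb := in_Loo_lax_symbol.
have Lb h : in_L2 h -> in_L2 (fun x => lax_symbol x * h x) by exact: in_LooM_L2.
have PB2 := is_orthoproj_L2plus (lax_BP P2).
rewrite (inner_orthoproj (Lb _ L1) (lax_BP P1) P2).
rewrite (innerC (in_L2plus_L2 PB2) L1) (inner_orthoproj (Lb _ L2) (lax_BP P2) P1).
rewrite -(innerC (Lb _ L2) L1) (inner_mull lax_symbol).
under [X in inner _ X]eq_fun do rewrite conj_lax_symbol mulNr -mulN1r.
by rewrite innerZr ?conjcN ?conjc1 ?mulN1r//; exact: Lb.
Qed.

(** The frequencies of q = e^{-ix} u conj(h) split into the nonnegative ones,
    collected by K_u h, and the negative ones: conj(u) h is conj(q) up to the
    shift, so that Pi (conj(u) h), once conjugated, collects the latter. *)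
Lemma shifted_Hankel_split h : in_L2plus h ->
  torus_ae_eq (K h) (fun x => cexp (- 1) x * (u x * ((h x)^*)%C)
    - cexp (- 1) x * ((Pi (fun y => ((u y)^*)%C * h y) x)^*)%C).
Proof.
move=> Ph; have Lh := in_L2plus_L2 Ph.
have Lr : in_L2 (fun y => ((u y)^*)%C * h y) by apply: in_LooM_L2 => //; exact: in_Loo_conj.
set p := Pi _; have [Pp rp] : is_orthoproj (fun y => ((u y)^*)%C * h y) p by exact: PiP.
have Lp := in_L2plus_L2 Pp.
have Le f : in_L2 f -> in_L2 (fun x => cexp (- 1) x * f x).
  by apply: in_LooM_L2; exact: in_Loo_cexp.
have Lq : in_L2 (fun x => cexp (- 1) x * (u x * ((h x)^*)%C)).
  by apply: Le; apply: in_LooM_L2 => //; exact: in_L2_conj.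
have Lep : in_L2 (fun x => cexp (- 1) x * ((p x)^*)%C) by apply: Le; exact: in_L2_conj.
have Ld := in_L2B Lq Lep.
apply: (is_orthoproj_unique Lq Lq (shifted_HankelP Bu Ph)) => //.
apply: is_orthoprojP => //.
  split => // k k0.
  have -> : (fun x => cexp (- 1) x * (u x * ((h x)^*)%C) - cexp (- 1) x * ((p x)^*)%C)
      = (fun x => cexp (- 1) x * ((((u x)^*)%C * h x - p x)^*)%C).
    by apply/funext => x; rewrite conjcB conjcM conjcK mulrBr.
  rewrite fourier_cexpM /fourier.
  have Lrp := in_L2B Lr Lp; have Lek := in_L2_cexp R (- (k - - 1)).
  have -> : inner (fun x => (((u x)^*)%C * h x - p x)^*%C) (cexp (k - - 1)) =
      ((inner (fun x => ((u x)^*)%C * h x - p x) (cexp (- (k - - 1))))^*)%C.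
    rewrite /inner conjcM conjc_real -cintegral_conj; last exact: inner_cintegrable.
    by congr (_ * cintegral _); apply/funext => x; rewrite conjcM conjcK !cexp_conj.
  by rewrite rp ?conjc0//; apply: in_L2plus_cexp; lia.
move=> g Pg; have Lg := in_L2plus_L2 Pg.
rewrite innerBl// [X in _ - X]innerC// [inner g _](_ : _ = 0) ?conjc0 ?subr0//.
under [X in inner _ X]eq_fun do rewrite mulrC.
exact: inner_conj_L2plus.
Qed.

(** This is J (|u|^2 - Pi(|u|^2)) when w is the time derivative of u, the term
    J Pi(|u|^2) being solved for in the equation. Written in this way it is
    visibly bounded, although Pi does not preserve boundedness in general. *)
Definition lax_defect w x : R[i] :=
  c * (normc (u x) ^+ 2)%:C - 2^-1 * ('i%C * w x - (c^*)%C * u x ^+ 2).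

Lemma in_Loo_lax_defect w : in_Loo w -> in_Loo (lax_defect w).
Proof.
move=> Bw; have B1 : in_Loo (fun x => (normc (u x) ^+ 2)%:C).
  under eq_fun do rewrite -mulcJE.
  by apply: in_LooM => //; exact: in_Loo_conj.
have B2 : in_Loo (fun x => u x ^+ 2) by under eq_fun do rewrite expr2; exact: in_LooM.
have -> : lax_defect w = (fun x => c * (normc (u x) ^+ 2)%:C +
    - 2^-1 * ('i%C * w x + - (c^*)%C * u x ^+ 2)).
  by apply/funext => x; rewrite /lax_defect; ring.
by apply: in_LooD; [exact: in_LooZ|apply: in_LooZ; apply: in_LooD; exact: in_LooZ].
Qed.

Variable ut : torus_fun R.
Hypothesis But : in_Loo ut.
Hypothesis utE : torus_ae_eq (fun x => 'i%C * ut x)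
  (fun x => 2 * J u * Pi (fun y => (normc (u y) ^+ 2)%:C) x + (c^*)%C * u x ^+ 2).

Lemma lax_defect_orthogonal h : in_L2plus h -> inner (lax_defect ut) h = 0.
Proof.
move=> Ph; have Lh := in_L2plus_L2 Ph.
have L1 : in_L2 (fun x => (normc (u x) ^+ 2)%:C).
  under eq_fun do rewrite -mulcJE.
  by apply: in_Loo_L2; apply: in_LooM => //; exact: in_Loo_conj.
have LP := in_L2plus_L2 (in_L2plus_Pi L1).
have -> : inner (lax_defect ut) h =
    inner (fun x => c * ((normc (u x) ^+ 2)%:C - Pi (fun y => (normc (u y) ^+ 2)%:C) x)) h.
  apply: (inner_ae_eq _ _ Lh Lh _ (torus_ae_eq_refl h)).
  - by apply: in_Loo_L2; exact: in_Loo_lax_defect.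
  - by apply: in_L2Z; exact: in_L2B.
  - apply: filterS utE => x + Tx => /(_ Tx) E.
    by rewrite /lax_defect E; field.
rewrite innerZl//; last exact: in_L2B.
by have [_ ->] := PiP L1; rewrite ?mulr0.
Qed.

(** The right-hand side is the value at h of the commutator of B_u and K_u; by
    [shifted_HankelP] the left-hand side is what the shifted Hankel operator of
    u_t projects. *)
Lemma lax_commutator h : in_L2plus h ->
  is_orthoproj (fun x => cexp (- 1) x * (ut x * ((h x)^*)%C))
    (fun x => lax_B u (K h) x - K (lax_B u h) x).
Proof.
move=> Ph; have Lh := in_L2plus_L2 Ph.
have KP := shifted_HankelP Bu Ph.
have Pk := is_orthoproj_L2plus KP; have Lk := in_L2plus_L2 Pk.
have PB := is_orthoproj_L2plus (lax_BP Ph); have LB := in_L2plus_L2 PB.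
set q := fun x => cexp (- 1) x * (u x * ((h x)^*)%C).
have Buc := in_Loo_conj Bu.
have Bb := in_Loo_lax_symbol.
have Le f : in_L2 f -> in_L2 (fun x => cexp (- 1) x * f x).
  by apply: in_LooM_L2; exact: in_Loo_cexp.
have Lq : in_L2 q by apply: Le; apply: in_LooM_L2 => //; exact: in_L2_conj.
have LQ : in_L2 (fun x => cexp (- 1) x * (u x * ((lax_B u h x)^*)%C)).
  by apply: Le; apply: in_LooM_L2 => //; exact: in_L2_conj.
have Lut : in_L2 (fun x => cexp (- 1) x * (ut x * ((h x)^*)%C)).
  by apply: Le; apply: in_LooM_L2 => //; exact: in_L2_conj.
have Lbk := in_LooM_L2 Bb Lk.
have LF := in_L2B Lbk LQ.
have FP := is_orthoprojB Lbk LQ (lax_BP Pk) (shifted_HankelP Bu PB).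
apply: (is_orthoproj_eq LF Lut _ FP) => g Pg; have Lg := in_L2plus_L2 Pg.
have Lr : in_L2 (fun y => ((u y)^*)%C * h y) by exact: in_LooM_L2.
set p := Pi (fun y => ((u y)^*)%C * h y).
have Lp : in_L2 p by apply: in_L2plus_L2; exact: in_L2plus_Pi.
have Puh := in_L2plusM Bu Pu Ph; have Luh := in_L2plus_L2 Puh.
have BE : torus_ae_eq (lax_B u h)
    (fun x => - 'i%C * ((c^*)%C * (u x * h x) + c * p x)).
  have L1 := in_L2Z (c^*)%C Luh; have L2 := in_L2Z c Lr.
  have L3 := in_L2Z (- 'i%C) (in_L2D L1 L2).
  apply: (is_orthoproj_unique (in_LooM_L2 Bb Lh) L3 (lax_BP Ph)).
    exact: (is_orthoprojZ (- 'i%C) (in_L2D L1 L2) (is_orthoprojD L1 L2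
      (is_orthoprojZ (c^*)%C Luh (is_orthoproj_id Puh)) (is_orthoprojZ c Lr (PiP Lr)))).
  move=> g' _; apply: eq_innerl => x.
  by rewrite /lax_symbol /lax_symbol1 /lax_symbol2; ring.
have Luk := in_LooM_L2 Buc Lk; have Luq := in_LooM_L2 Buc Lq.
have Luuq := in_LooM_L2 Bu Lq.
pose F1 x := - 'i%C * ((c^*)%C * (u x * q x) + c * (((u x)^*)%C * q x)).
have LF1 : in_L2 F1 by apply: in_L2Z; apply: in_L2D; exact: in_L2Z.
have L2k : in_L2 (fun x => - 'i%C * c * (((u x)^*)%C * K h x)) by exact: in_L2Z.
(* By [shifted_Hankel_split], the two terms in conj(J) add up to u q, as
   K_u (Pi (conj(u) h)) comes from u times the negative part of q. *)
have -> : inner (fun x => lax_symbol x * K h x -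
      cexp (- 1) x * (u x * ((lax_B u h x)^*)%C)) g =
    inner (fun x => F1 x + - 'i%C * c * (((u x)^*)%C * K h x)) g.
  apply: (inner_ae_eq LF (in_L2D LF1 L2k) Lg Lg _ (torus_ae_eq_refl g)).
  apply: filterS2 BE (shifted_Hankel_split Ph) => x + + Tx => /(_ Tx) -> /(_ Tx) KE.
  rewrite KE /lax_symbol /lax_symbol1 /lax_symbol2 /F1 /q -/p.
  move: (J u) (u x) (h x) (p x) (cexp _ x) => a z y r e.
  by rewrite conjcM conjcD !conjcM conjcN conjcK conj_i; ring.
have kq : inner (fun x => ((u x)^*)%C * K h x) g = inner (fun x => ((u x)^*)%C * q x) g.
  apply: (inner_mul_orthoproj (b := fun x => ((u x)^*)%C) Lq KP).
  by under eq_fun do rewrite conjcK; exact: in_L2plusM.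
have L2q : in_L2 (fun x => - 'i%C * c * (((u x)^*)%C * q x)) by exact: in_L2Z.
(* The two terms in J both pair with g as conj(u) q does; they differ from
   2 J Pi(|u|^2) by the defect, which pairs to zero. *)
have LD : in_L2 (fun x => lax_defect ut x * ((h x)^*)%C).
  by apply: in_LooM_L2; [exact: in_Loo_lax_defect|exact: in_L2_conj].
have D0 : inner (fun x => cexp (- 1) x * (lax_defect ut x * ((h x)^*)%C)) g = 0.
  rewrite (inner_mull (cexp (- 1))); apply: inner_orthogonal => //.
  - exact: in_Loo_lax_defect.
  - exact: lax_defect_orthogonal.
  - by under eq_fun do rewrite cexp_conj opprK; exact: in_L2plus_shift.
have LeD := in_L2Z (- 2 * 'i%C) (Le _ LD).
rewrite (innerDl LF1 L2k Lg) (innerZl _ Luk Lg) kq.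
rewrite -(innerZl _ Luq Lg) -(innerDl LF1 L2q Lg).
rewrite -[RHS]addr0 -(mulr0 (- 2 * 'i%C)) -D0 -(innerZl _ (Le _ LD) Lg) -(innerDl Lut LeD Lg).
apply: eq_innerl => x; rewrite /F1 /q /lax_defect -mulcJE.
move: (J u) (u x) (h x) (ut x) (cexp _ x) => a z y r e.
have i2 : 'i%C * 'i%C = -1 :> R[i] by rewrite -expr2 sqr_i.
transitivity ((1 + 'i%C * 'i%C) * (e * (r * (y^*)%C)) +
    - 'i%C * (e * (y^*)%C * ((a^*)%C * z ^+ 2 + 2 * a * (z * (z^*)%C)))).
  by rewrite i2 subrr mul0r add0r; ring.
by field.
Qed.

End Symbol.

(** The shifted Hankel operator is real-linear in its symbol and its operator
    norm is at most the L^oo norm of the symbol, so that differentiation in H^s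
    passes to the operator norm through the Sobolev embedding. *)
Lemma shifted_Hankel_deriv s (u : R -> torus_fun R) t w :
  2^-1 < s -> (forall t', in_Hsplus s (u t')) -> in_Hsplus s w ->
  Hs_deriv s u t w ->
  forall A' : torus_fun R -> torus_fun R,
  (forall h, in_L2plus h ->
    is_orthoproj (fun x => cexp (- 1) x * (w x * ((h x)^*)%C)) (A' h)) ->
  op_deriv (fun t' => shifted_Hankel (u t')) t A'.
Proof.
move=> s12 Hu Hw uw A' A'P; have [C C0 CP] := sobolev s12.
pose v tau x := (tau^-1)%:C * (u (t + tau) x - u t x) - w x.
have Pv tau : in_L2plus (v tau).
  apply: in_L2plusB; last exact: Hw.1.
  by apply: in_L2plusZ; apply: in_L2plusB; exact: (Hu _).1.
have Bu t' : in_Loo (u t') by exact: in_Hsplus_Loo (Hu t').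
have Bw : in_Loo w by exact: in_Hsplus_Loo Hw.
have bound tau : (opnorm (fun h x => (tau^-1)%:C *
    (shifted_Hankel (u (t + tau)) h x - shifted_Hankel (u t) h x) - A' h x)%R
    <= C%:E * Hsnorm s (v tau))%E.
  have H0 : (0 <= Hsnorm s (v tau))%E by exact: poweR_ge0.
  have [Hy|] := eqVneq (Hsnorm s (v tau)) +oo%E.
    by rewrite Hy gt0_muley ?lte_fin// leey.
  rewrite -ltey -ge0_fin_numE// => /fineK HE.
  apply/lee_addgt0Pr => e e0; have eC : 0 < e / C by rewrite divr_gt0.
  have -> : (C%:E * Hsnorm s (v tau) + e%:E = (C * (fine (Hsnorm s (v tau)) + e / C))%:E)%E.
    by rewrite -HE -EFinM -EFinD; congr EFin; field; rewrite gt_eqF.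
  have ep : 0 < fine (Hsnorm s (v tau)) + e / C by rewrite ltr_wpDl// fine_ge0.
  have vM : {ae mu, forall x, T x -> normc (v tau x) <= C * (fine (Hsnorm s (v tau)) + e / C)}.
    apply: CP => //; first exact: (Pv tau).1.
    by rewrite -{1}HE lee_fin lerDl ltW.
  have Bv : in_Loo (v tau).
    by split; [case: (Pv tau) => -[]|eexists; exact: vM].
  apply: opnorm_le => h Ph h1; have Lh := in_L2plus_L2 Ph.
  have Lhb := in_L2_conj Lh.
  have Lq f : in_Loo f -> in_L2 (fun x => cexp (- 1) x * (f x * ((h x)^*)%C)).
    by move=> Bf; apply: in_LooM_L2; [exact: in_Loo_cexp|exact: in_LooM_L2].
  have := is_orthoprojB (in_L2Z (tau^-1)%:C (in_L2B (Lq _ (Bu (t + tau))) (Lq _ (Bu t)))) (Lq _ Bw)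
    (is_orthoprojZ (tau^-1)%:C (in_L2B (Lq _ (Bu (t + tau))) (Lq _ (Bu t)))
      (is_orthoprojB (Lq _ (Bu (t + tau))) (Lq _ (Bu t))
        (shifted_HankelP (Bu (t + tau)) Ph) (shifted_HankelP (Bu t) Ph))) (A'P h Ph).
  set G := (fun x => _ - A' h x) => GP.
  have {}GP : is_orthoproj (fun x => cexp (- 1) x * (v tau x * ((h x)^*)%C)) G.
    apply: is_orthoproj_eq GP; last first.
    - move=> g _; apply: eq_innerl => x; rewrite /v; ring.
    - exact: Lq.
    - by apply: in_L2B; [apply: in_L2Z; apply: in_L2B|]; exact: Lq.
  have LG := in_L2plus_L2 (is_orthoproj_L2plus GP).
  rewrite L2norm_le//; last by rewrite mulr_ge0 ?ltW.
  apply: le_trans (L2sq_orthoproj (Lq _ Bv) GP) _.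
  set M := C * _ in vM *; have M0 : 0 <= M by rewrite mulr_ge0 ?ltW.
  apply: (@le_trans _ _ (L2sq (fun x => M%:C * h x))).
    apply: L2sq_le; [exact: Lq|exact: in_L2Z|].
    apply: filterS vM => x + Tx => /(_ Tx) vM.
    rewrite !ComplexField.Normc.normcM normc_cexp normc_conj mul1r normc_real ger0_norm//.
    by rewrite ler_wpM2r ?normc_ge0.
  rewrite L2sqZ// normc_real real_normK ?num_real// ler_piMr ?sqr_ge0//.
  by rewrite -[leRHS](expr1n _ 2) -L2norm_le.
rewrite /op_deriv.
apply: (@squeeze_cvge _ _ _ _ (cst 0%E) _ (fun tau => C%:E * Hsnorm s (v tau))%E).
- by apply: nearW => tau; rewrite opnorm_ge0 bound.
- exact: cvg_cst.
- by rewrite -[X in _ --> X](mule0 C%:E); apply: cvgeZl.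
Qed.

End LaxPair.

Theorem theorem2 (R : realType) (s : R) (u : R -> torus_fun R) :
  2^-1 < s ->
  smooth_Hsplus s u ->
  is_solution s u ->
  forall t : R,
    [/\ in_Loo (lax_symbol1 (u t)) /\ in_Loo (lax_symbol2 (u t)),
        bounded_linear_L2plus (lax_B (u t)),
        anti_selfadjoint (lax_B (u t))
      & op_deriv (fun t' => shifted_Hankel (u t')) t
          (fun h x => lax_B (u t) (shifted_Hankel (u t) h) x
                      - shifted_Hankel (u t) (lax_B (u t) h) x)].
Proof.
move=> s12 [v [v0 Hv _]] sol t.
have Hu t' : in_Hsplus s (u t') by rewrite -v0; exact: Hv.
have Bu := in_Hsplus_Loo s12 (Hu t); have Pu := (Hu t).1.
have [w [Hw uw wE]] := sol t.
split.
- by split; [exact: in_Loo_lax_symbol1|exact: in_Loo_lax_symbol2].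
- exact: bounded_linear_lax_B.
- exact: anti_selfadjoint_lax_B.
- apply: (shifted_Hankel_deriv s12 Hu Hw uw) => h Ph.
  by apply: lax_commutator => //; exact: in_Hsplus_Loo Hw.
Qed.
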